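(* Let $(R, M)$ be a local ring with $M$-adic completion $T$ and let $I$ be an ideal of $R$. Then there exists a faithfully flat local extension ring $(S, N)$ of $R$ whose completion at $N$ is also equal to $T$, such that $S/IS \cong R/I$ (and in particular $\operatorname{Spec}(S/IS) \cong \operatorname{Spec}(R/I)$) and such that, for any chain $Q_1 \subsetneq Q_2 \subsetneq Q_3$ of prime ideals of $S$ such that $IS \nsubseteq Q_1$, there are $|\operatorname{Spec}(T)|$ prime ideals $Q'$ of $S$ with $Q_1 \subsetneq Q' \subsetneq Q_3$.
   Context: All rings are commutative with $1$. ''Local'' means Noetherian with exactly one maximal ideal; $(R,M)$ local means $M$ is the maximal ideal of $R$, and likewise $(S,N)$ is a local ring with maximal ideal $N$. Equality of completions is understood up to ring isomorphism: the completion of $S$ at $N$ is the $N$-adic completion $\varprojlim S/N^k$, and it is isomorphic to $T=\varprojlim R/M^k$. *)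

(* Defs.v *)
From HB Require Import structures.
From mathcomp Require Import all_boot all_order all_algebra.
From mathcomp Require Import generic_quotient ring_quotient sesquilinear.
From mathcomp Require Import mathcomp_extra boolp classical_sets functions.
From mathcomp Require Import cardinality topology_structure.

Set Implicit Arguments.
Unset Strict Implicit.
Unset Printing Implicit Defensive.

Import GRing.Theory.

Local Open Scope classical_set_scope.
Local Open Scope ring_scope.
Local Open Scope quotient_scope.

Section Ideals.
Variable R : comPzRingType.
Implicit Types I J E : set R.

(* [is_ideal] allows the unit ideal [setT], unlike the library's [idealr]. *)
Definition is_ideal I :=
  [/\ I 0, forall x y, I x -> I y -> I (x + y) & forall a x, I x -> I (a * x)].

Record ideal := Ideal { ideal_set :> set R ; ideal_setP : is_ideal ideal_set }.

Lemma smallest_is_ideal E : is_ideal (smallest is_ideal E).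
Proof.
split=> [J [[J0 _ _] _] //|x y Ex Ey J JE|a x Ex J JE].
  by case: (JE) => -[_ JD _] _; apply: JD; [exact: Ex|exact: Ey].
by case: (JE) => -[_ _ JM] _; apply: JM; exact: Ex.
Qed.

Definition ideal_gen E : ideal := Ideal (smallest_is_ideal E).

Lemma is_ideal_setT : is_ideal setT.
Proof. by []. Qed.

Definition ideal_mul I J : ideal := ideal_gen [set x * y | x in I & y in J].

Fixpoint ideal_pow (I : ideal) (k : nat) : ideal :=
  if k is k'.+1 then ideal_mul I (ideal_pow I k') else Ideal is_ideal_setT.

Definition prime_ideal I :=
  [/\ is_ideal I, ~ I 1 & forall x y, I (x * y) -> I x \/ I y].

Definition maximal_ideal I :=
  [/\ is_ideal I, I <> setT &
      forall J, is_ideal J -> I `<=` J -> J = I \/ J = setT].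

Definition noetherian :=
  forall J : ideal, exists s : seq R, (J : set R) = ideal_gen [set` s].

Definition local_ring I :=
  [/\ noetherian, maximal_ideal I & forall J, maximal_ideal J -> J = I].

Definition Spec : set (set R) := [set P | prime_ideal P].

End Ideals.

Arguments Spec : clear implicits.

Definition ring_isom (A B : pzRingType) :=
  exists f : {rmorphism A -> B}, bijective f.

Section RingQuotient.
Variables (R : comPzRingType) (I : ideal R).

Definition ideal_pred : {pred R} := fun x => `[< ideal_set I x >].

Lemma ideal_pred_zmod_closed : zmod_closed ideal_pred.
Proof.
case: (ideal_setP I) => I0 ID IM; split; first exact/asboolP.
move=> x y /asboolP Ix /asboolP Iy; apply/asboolP.
by apply: ID => //; rewrite -mulN1r; exact: IM.
Qed.

HB.instance Definition _ :=
  GRing.isZmodClosed.Build R ideal_pred ideal_pred_zmod_closed.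

(* The library equips [{ideal_quot _}] with a ring structure for proper ideals
   only; the alias [ring_quot] receives one for every ideal, so that [R / R] is
   the zero ring. *)
Definition ring_quot : Type := {ideal_quot ideal_pred}.

HB.instance Definition _ := GRing.Zmodule.on ring_quot.
HB.instance Definition _ := Quotient.on ring_quot.

Let quot_eqP (x y : R) : \pi_ring_quot x = \pi_ring_quot y <-> ideal_set I (x - y).
Proof.
split=> [/eqP|Ixy]; first by rewrite -Quotient.idealrBE => /asboolP.
by apply/eqP; rewrite -Quotient.idealrBE; apply/asboolP.
Qed.

Definition ring_quot_one : ring_quot := \pi_ring_quot (1 : R).
Definition ring_quot_mul (x y : ring_quot) : ring_quot := \pi_ring_quot (repr x * repr y : R).

Let pi_mul (x y : R) :
  ring_quot_mul (\pi_ring_quot x) (\pi_ring_quot y) = \pi_ring_quot (x * y).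
Proof.
case: (ideal_setP I) => _ ID IM; apply/quot_eqP.
have Ix : ideal_set I (repr (\pi_ring_quot x) - x) by apply/quot_eqP; rewrite reprK.
have Iy : ideal_set I (repr (\pi_ring_quot y) - y) by apply/quot_eqP; rewrite reprK.
set x' := repr _ in Ix *; set y' := repr _ in Iy *.
have -> : x' * y' - x * y = y' * (x' - x) + x * (y' - y).
  by rewrite !mulrBr [y' * x']mulrC [y' * x]mulrC addrA subrK.
by apply: ID; apply: IM.
Qed.

Let pi_add (x y : R) : \pi_ring_quot x + \pi_ring_quot y = \pi_ring_quot (x + y).
Proof. by symmetry; exact: (@Quotient.pi_add R ideal_pred x y). Qed.

Let mulA : associative ring_quot_mul.
Proof.
move=> x y z; rewrite -[x]reprK -[y]reprK -[z]reprK.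
move: (repr x) (repr y) (repr z) => a b c.
by rewrite (pi_mul a b) (pi_mul b c) !pi_mul mulrA.
Qed.

Let mulC : commutative ring_quot_mul.
Proof. by move=> x y; rewrite /ring_quot_mul mulrC. Qed.

Let mul1 : left_id ring_quot_one ring_quot_mul.
Proof. by move=> x; rewrite -[x]reprK pi_mul mul1r. Qed.

Let mulDl : left_distributive ring_quot_mul +%R.
Proof.
move=> x y z; rewrite -[x]reprK -[y]reprK -[z]reprK.
move: (repr x) (repr y) (repr z) => a b c.
by rewrite (pi_add a b) (pi_mul a c) (pi_mul b c) !pi_mul pi_add mulrDl.
Qed.

HB.instance Definition _ :=
  GRing.Zmodule_isComPzRing.Build ring_quot mulA mulC mul1 mulDl.

Lemma ring_quot_eqP (x y : R) :
  \pi_ring_quot x = \pi_ring_quot y <-> ideal_set I (x - y).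
Proof. exact: quot_eqP. Qed.

Lemma pi_ring_quot_is_zmod_morphism : zmod_morphism \pi_ring_quot.
Proof. exact: (@pi_is_zmod_morphism R _ 0 (Quotient.quot ideal_pred)). Qed.

Lemma pi_ring_quot_is_monoid_morphism : monoid_morphism \pi_ring_quot.
Proof. by split=> // x y; rewrite -pi_mul. Qed.

HB.instance Definition _ :=
  GRing.isZmodMorphism.Build R ring_quot \pi_ring_quot
    pi_ring_quot_is_zmod_morphism.
HB.instance Definition _ :=
  GRing.isMonoidMorphism.Build R ring_quot \pi_ring_quot
    pi_ring_quot_is_monoid_morphism.

End RingQuotient.

Section QuotientMap.
Variables (R : comPzRingType) (J I : ideal R).

(* The canonical map R/J -> R/I, for J included in I. *)
Definition quot_trans (x : ring_quot J) : ring_quot I :=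
  \pi_(ring_quot I) (repr x : R).

Hypothesis JI : J `<=` I.

Lemma quot_trans_pi (r : R) :
  quot_trans (\pi_(ring_quot J) r) = \pi_(ring_quot I) r.
Proof. by apply/ring_quot_eqP/JI/ring_quot_eqP; rewrite reprK. Qed.

Lemma quot_transB : zmod_morphism quot_trans.
Proof.
move=> x y; rewrite -[x]reprK -[y]reprK; move: (repr x) (repr y) => a b.
rewrite -(@pi_ring_quot_is_zmod_morphism R J a b) !quot_trans_pi.
exact: pi_ring_quot_is_zmod_morphism.
Qed.

Lemma quot_transM : {morph quot_trans : x y / x * y}.
Proof.
move=> x y; rewrite -[x]reprK -[y]reprK; move: (repr x) (repr y) => a b.
rewrite -((@pi_ring_quot_is_monoid_morphism R J).2 a b) !quot_trans_pi.
exact: (@pi_ring_quot_is_monoid_morphism R I).2.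
Qed.

End QuotientMap.
Arguments quot_trans [R J] I x.

Section DepProduct.
Variables (K : Type) (A : K -> comPzRingType).

Definition dep_prod : Type := forall k, A k.

HB.instance Definition _ := gen_eqMixin dep_prod.
HB.instance Definition _ := gen_choiceMixin dep_prod.

Let pzero : dep_prod := fun=> 0.
Let pone : dep_prod := fun=> 1.
Let popp (f : dep_prod) : dep_prod := fun k => - f k.
Let padd (f g : dep_prod) : dep_prod := fun k => f k + g k.
Let pmul (f g : dep_prod) : dep_prod := fun k => f k * g k.

Let paddA : associative padd.
Proof. by move=> f g h; apply: functional_extensionality_dep => k; exact: addrA. Qed.
Let paddC : commutative padd.
Proof. by move=> f g; apply: functional_extensionality_dep => k; exact: addrC. Qed.
Let padd0 : left_id pzero padd.
Proof. by move=> f; apply: functional_extensionality_dep => k; exact: add0r. Qed.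
Let paddN : left_inverse pzero popp padd.
Proof. by move=> f; apply: functional_extensionality_dep => k; exact: addNr. Qed.

HB.instance Definition _ :=
  GRing.isZmodule.Build dep_prod paddA paddC padd0 paddN.

Let pmulA : associative pmul.
Proof. by move=> f g h; apply: functional_extensionality_dep => k; exact: mulrA. Qed.
Let pmulC : commutative pmul.
Proof. by move=> f g; apply: functional_extensionality_dep => k; exact: mulrC. Qed.
Let pmul1 : left_id pone pmul.
Proof. by move=> f; apply: functional_extensionality_dep => k; exact: mul1r. Qed.
Let pmulDl : left_distributive pmul padd.
Proof. by move=> f g h; apply: functional_extensionality_dep => k; exact: mulrDl. Qed.

HB.instance Definition _ :=
  GRing.Zmodule_isComPzRing.Build dep_prod pmulA pmulC pmul1 pmulDl.

End DepProduct.

Section Completion.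
Variables (R : comPzRingType) (I : ideal R).

Let quot_pow k : comPzRingType := ring_quot (ideal_pow I k).

Definition compatible : {pred dep_prod quot_pow} := fun x =>
  `[< forall k, quot_trans (ideal_pow I k) (x k.+1) = x k >].

Lemma ideal_powS_sub k : ideal_pow I k.+1 `<=` ideal_pow I k.
Proof.
move=> x; apply: smallest_sub; first exact: ideal_setP.
move=> _ [a _ [b Ib <-]]; case: (ideal_setP (ideal_pow I k)) => _ _; exact.
Qed.

Lemma compatible_subring_closed : subring_closed compatible.
Proof.
have JI k := @ideal_powS_sub k; split.
- by apply/asboolP => k; exact (quot_trans_pi (@JI k) 1).
- move=> x y /asboolP Cx /asboolP Cy; apply/asboolP => k.
  by apply: (etrans (quot_transB (@JI k) _ _)); rewrite Cx Cy.
- move=> x y /asboolP Cx /asboolP Cy; apply/asboolP => k.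
  by apply: (etrans (quot_transM (@JI k) _ _)); rewrite Cx Cy.
Qed.

(* The inverse limit of the rings R/I^k. *)
Record completion : Type := Completion {
  completion_val : dep_prod quot_pow ;
  completion_valP : completion_val \in compatible }.

HB.instance Definition _ := [isSub for completion_val].
HB.instance Definition _ := [Choice of completion by <:].
HB.instance Definition _ :=
  GRing.SubChoice_isSubComPzRing.Build _ compatible completion
    compatible_subring_closed.

End Completion.

Section Zariski.
Variable R : comPzRingType.

Definition spec : Type := Spec R.

HB.instance Definition _ := Choice.on spec.

Definition zariski_open : set_system spec :=
  [set U | exists E : set R, U = [set P : spec | ~ (E `<=` val P)]].

Lemma spec_prime (P : spec) : prime_ideal (val P).
Proof. exact: (set_mem (valP P)). Qed.

Lemma zariski_openT : zariski_open setT.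
Proof.
exists setT; apply/seteqP; split=> // P _ /=.
by case: (spec_prime P) => _ P1 _ /(_ 1 I).
Qed.

Lemma zariski_openI : setI_closed zariski_open.
Proof.
move=> _ _ [E ->] [F ->]; exists [set x * y | x in E & y in F].
apply/seteqP; split=> P /=; case: (spec_prime P) => -[_ _ PM] _ Pp.
  move=> [/existsNP[x /not_implyP[Ex Px]] /existsNP[y /not_implyP[Fy Py]]] sEF.
  by have [] : val P x \/ val P y by apply/Pp/sEF; exists x => //; exists y.
move=> nEF; split=> sP; apply: nEF => _ [x Ex [y Fy <-]].
  by rewrite mulrC; apply/PM/sP.
exact/PM/sP.
Qed.

Lemma zariski_open_bigU (K : Type) (f : K -> set spec) :
  (forall i, zariski_open (f i)) -> zariski_open (\bigcup_i f i).
Proof.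
move=> /choice[E fE]; exists (\bigcup_i E i); apply/seteqP; split=> P /=.
  move=> [i _]; rewrite fE /= => nEi sE; apply: nEi => x Ex.
  by apply: sE; exists i.
move=> /existsNP[x /not_implyP[[i _ Eix] Px]]; exists i => //.
by rewrite fE /= => sE; apply/Px/sE.
Qed.

HB.instance Definition _ := isOpenTopological.Build spec
  zariski_openT zariski_openI zariski_open_bigU.

End Zariski.

Arguments spec : clear implicits.

Definition homeomorphic (X Y : topologicalType) :=
  exists (f : X -> Y) (g : Y -> X),
    [/\ continuous f, continuous g, cancel f g & cancel g f].

Section Tensor.
Variables (R : comNzRingType) (A B : lmodType R).

Definition formal_eval (W : lmodType R) (b : A -> B -> W) (s : seq (A * B)) :=
  \sum_(p <- s) b p.1 p.2.

(* A list of pairs (a, b) stands for the sum of the tensors a (x) b. Two lists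
   represent the same tensor when no bilinear map tells their sums apart; the
   lemmas [tensor_lift_tens] and [tensor_lift_unique] give the universal
   property of the tensor product. *)
Definition tensor_equiv (s t : seq (A * B)) : bool :=
  `[< forall (W : lmodType R) (b : {bilinear A -> B -> W}),
        formal_eval b s = formal_eval b t >].

Lemma tensor_equiv_is_equiv : equiv_class_of tensor_equiv.
Proof.
split=> [s|s t|t s u].
- exact/asboolP.
- by apply/asboolP/asboolP => st W b; rewrite st.
- by move=> /asboolP st /asboolP tu; apply/asboolP => W b; rewrite st.
Qed.

Canonical tensor_equiv_equiv := EquivRelPack tensor_equiv_is_equiv.

Definition tensor : Type := {eq_quot tensor_equiv}.

HB.instance Definition _ := Choice.on tensor.
HB.instance Definition _ := Quotient.on tensor.

Definition tensor_lift (W : lmodType R) (b : A -> B -> W) (x : tensor) : W :=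
  formal_eval b (repr x).

Lemma tensor_lift_pi (W : lmodType R) (b : {bilinear A -> B -> W}) s :
  tensor_lift b (\pi_tensor s) = formal_eval b s.
Proof.
suff /asboolP : tensor_equiv (repr (\pi_tensor s)) s by apply.
by apply/eqmodP; rewrite reprK.
Qed.

Lemma tensor_ext (x y : tensor) :
  (forall (W : lmodType R) (b : {bilinear A -> B -> W}),
     tensor_lift b x = tensor_lift b y) -> x = y.
Proof.
move=> xy; rewrite -[x]reprK -[y]reprK; apply/eqmodP/asboolP => W b.
exact: xy.
Qed.

Let class (s : seq (A * B)) : tensor := \pi_tensor s.
Let zero : tensor := class [::].
Let add (x y : tensor) : tensor := class (repr x ++ repr y).
Let scale (r : R) (x : tensor) : tensor :=
  class [seq (r *: p.1, p.2) | p <- repr x].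
Let opp (x : tensor) : tensor := scale (-1) x.

Section Lift.
Variables (W : lmodType R) (b : {bilinear A -> B -> W}).

Let lift0 : tensor_lift b zero = 0.
Proof. by rewrite tensor_lift_pi /formal_eval big_nil. Qed.

Let liftD x y : tensor_lift b (add x y) = tensor_lift b x + tensor_lift b y.
Proof. by rewrite tensor_lift_pi /formal_eval big_cat. Qed.

Let liftZ r x : tensor_lift b (scale r x) = r *: tensor_lift b x.
Proof.
rewrite tensor_lift_pi /tensor_lift /formal_eval big_map scaler_sumr.
by apply: eq_bigr => p _ /=; rewrite linearZl.
Qed.

Let liftN x : tensor_lift b (opp x) = - tensor_lift b x.
Proof. by rewrite liftZ scaleN1r. Qed.

Definition liftE := (lift0, liftD, liftZ, liftN).
End Lift.

Let addA : associative add.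
Proof. by move=> x y z; apply: tensor_ext => W b; rewrite !liftE addrA. Qed.
Let addC : commutative add.
Proof. by move=> x y; apply: tensor_ext => W b; rewrite !liftE addrC. Qed.
Let add0 : left_id zero add.
Proof. by move=> x; apply: tensor_ext => W b; rewrite !liftE add0r. Qed.
Let addN : left_inverse zero opp add.
Proof. by move=> x; apply: tensor_ext => W b; rewrite !liftE addNr. Qed.

HB.instance Definition _ := GRing.isZmodule.Build tensor addA addC add0 addN.

Let scaleA r s x : scale r (scale s x) = scale (r * s) x.
Proof. by apply: tensor_ext => W b; rewrite !liftE scalerA. Qed.
Let scale1 : left_id 1 scale.
Proof. by move=> x; apply: tensor_ext => W b; rewrite !liftE scale1r. Qed.
Let scaleDr : right_distributive scale +%R.
Proof.
by move=> r x y; apply: tensor_ext => W b; rewrite -[_ + _]/(add _ _)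
  -[X in _ = tensor_lift _ X]/(add _ _) !liftE scalerDr.
Qed.
Let scaleDl x : {morph scale^~ x : r s / r + s}.
Proof.
move=> r s; apply: tensor_ext => W b.
by rewrite -[X in _ = tensor_lift _ X]/(add _ _) !liftE scalerDl.
Qed.

HB.instance Definition _ :=
  GRing.Zmodule_isLmodule.Build R tensor scaleA scale1 scaleDr scaleDl.

Definition tens (a : A) (b : B) : tensor := class [:: (a, b)].

Lemma tensor_lift_is_linear (W : lmodType R) (b : {bilinear A -> B -> W}) :
  linear (tensor_lift b).
Proof.
move=> r x y.
by rewrite -[X in tensor_lift _ X]/(add (scale r x) y) !liftE.
Qed.

HB.instance Definition _ (W : lmodType R) (b : {bilinear A -> B -> W}) :=
  GRing.isLinear.Build R tensor W _ (tensor_lift b) (tensor_lift_is_linear b).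

Lemma tensor_lift_tens (W : lmodType R) (b : {bilinear A -> B -> W}) x y :
  tensor_lift b (tens x y) = b x y.
Proof. by rewrite tensor_lift_pi /formal_eval big_seq1. Qed.

Lemma tens_is_bilinear :
  bilinear_for (GRing.Scale.Law.clone _ _ *:%R _)
    (GRing.Scale.Law.clone _ _ *:%R _) tens.
Proof.
split=> [y r x x'|x r y y']; apply: tensor_ext => W b;
  by rewrite tensor_lift_is_linear !tensor_lift_tens ?linearPl ?linearPr.
Qed.

HB.instance Definition _ :=
  bilinear_isBilinear.Build R A B tensor _ _ tens tens_is_bilinear.

Lemma tensorE (s : seq (A * B)) : \pi_tensor s = \sum_(p <- s) tens p.1 p.2.
Proof.
elim: s => [|[x y] s IH]; first by rewrite big_nil.
rewrite big_cons -IH; apply: tensor_ext => W b.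
rewrite -[X in _ = tensor_lift _ X]/(add _ _) liftE tensor_lift_tens.
by rewrite !tensor_lift_pi /formal_eval big_cons.
Qed.

Lemma tensor_lift_unique (W : lmodType R) (b : {bilinear A -> B -> W})
    (h : {linear tensor -> W}) :
  (forall x y, h (tens x y) = b x y) -> h =1 tensor_lift b.
Proof.
move=> hb t; rewrite -[t]reprK tensorE !linear_sum.
by apply: eq_bigr => p _; rewrite hb; symmetry; exact: tensor_lift_tens.
Qed.

End Tensor.

Section FaithfullyFlat.
Variable R : comNzRingType.

Definition tens_comp (S A B : lmodType R) (f : {linear A -> B}) (a : A) (s : S) :
  tensor B S := tens (f a) s.

Lemma tens_comp_is_bilinear (S A B : lmodType R) (f : {linear A -> B}) :
  bilinear_for (GRing.Scale.Law.clone _ _ *:%R _)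
    (GRing.Scale.Law.clone _ _ *:%R _) (tens_comp (S := S) f).
Proof.
by split=> [s r a a'|a r s s']; rewrite /tens_comp ?linearP ?linearPl ?linearPr.
Qed.

HB.instance Definition _ (S A B : lmodType R) (f : {linear A -> B}) :=
  bilinear_isBilinear.Build R A S (tensor B S) _ _ (tens_comp f)
    (tens_comp_is_bilinear S f).

Definition tensor_map (S A B : lmodType R) (f : {linear A -> B}) :
    tensor A S -> tensor B S :=
  tensor_lift (tens_comp (S := S) f).

HB.instance Definition _ (S A B : lmodType R) (f : {linear A -> B}) :=
  GRing.Linear.on (tensor_map (S := S) f).

Lemma tensor_map_tens (S A B : lmodType R) (f : {linear A -> B}) a (s : S) :
  tensor_map f (tens a s) = tens (f a) s.
Proof. exact: tensor_lift_tens. Qed.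

Definition exact_sequence (A B C : lmodType R) (f : A -> B) (g : B -> C) :=
  range f = [set y | g y = 0].

(* S is faithfully flat when a sequence A -> B -> C of R-modules is exact if
   and only if A (x) S -> B (x) S -> C (x) S is. *)
Definition faithfully_flat (S : lmodType R) :=
  forall (A B C : lmodType R) (f : {linear A -> B}) (g : {linear B -> C}),
    exact_sequence f g <->
    exact_sequence (tensor_map (S := S) f) (tensor_map (S := S) g).

End FaithfullyFlat.

(* The extension IS of the ideal I to the R-algebra S. *)
Definition ideal_ext (R : comNzRingType) (S : comAlgType R) (I : ideal R) :
  ideal S := ideal_gen (GRing.in_alg S @` I).

(* Injectivity of the structure map makes S an extension ring of R. *)
Definition local_extension (R : comNzRingType) (M : ideal R)
    (S : comAlgType R) (N : ideal S) :=
  [/\ local_ring N, injective (GRing.in_alg S) &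
      GRing.in_alg S @` M `<=` N].

(* Main.v *)
Require Import Defs.
From HB Require Import structures.
From mathcomp Require Import all_boot all_order all_algebra.
From mathcomp Require Import generic_quotient sesquilinear ring.
From mathcomp Require Import boolp classical_sets functions.
From mathcomp Require Import cardinality topology_structure.

Set Implicit Arguments.
Unset Strict Implicit.
Unset Printing Implicit Defensive.

Import GRing.Theory.

Local Open Scope classical_set_scope.
Local Open Scope card_scope.
Local Open Scope ring_scope.
Local Open Scope quotient_scope.

(** The ring [S] is the [J]-adic completion of [R], where [J = I] if [I] is a
    proper ideal and [J = M] otherwise. In the second case [IS = S], so that any
    [S] with the other properties has [S/IS = R/I = 0].

    The completion is used only through [is_completion]: the image of [R] is
    dense, the [J]-adic topology of [S] induces that of [R], and [S] is separated
    and complete. From these axioms [S] is Noetherian ([completion_noetherian], by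
    division with remainder and convergent series), local with maximal ideal [MS]
    ([ext_local]), and flat: a weak form of the Artin-Rees lemma shows that
    extension of ideals to [S] commutes with colons ([ext_colon]), whence the
    equational criterion of flatness ([completion_flat]). Over a local ring this
    makes [S] faithfully flat ([faithfully_flatP]): for a module that satisfies
    the equational criterion, a tensor vanishes exactly when it already vanishes
    in some [B (x) R ^ m]. The quotients of [R] and [S] by powers of the maximal
    ideals agree, and therefore so do the completions; for the same reason
    [S/IS = R/I].

    The number of intermediate primes is found by comparing both sides with the
    set of sequences of elements of the residue field [k].

    At least that many: let [z] in [JS] lie outside [Q1]. As [S] is complete, a
    sequence [c] in [k] defines a power series [u c] in [z], and the difference of
    two such series is a power of [z] times a unit ([digit_series]). Choose [y] in
    [Q2] outside [Q1] and divisible by [z], and [x] in [Q3] outside the minimal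
    primes of [Q1 + (y)]. Primes minimal over [Q1 + (x + u c * y)] lie strictly
    between [Q1] and [Q3] by the principal ideal theorem, and are distinct for
    distinct [c] ([many_intermediate_primes]). On the other hand, the completion
    [T] is Noetherian and its elements are given by countably many digits in [k],
    so that [T] has at most as many ideals as there are sequences in [k]
    ([card_Spec_completion]).

    At most [|Spec T|]: every prime of [S] is the contraction of a prime of the
    completion of [S] ([contraction_surj]), and that completion is [T]. *)

(** * Ideals *)

Notation mulI I J := (ideal_set (ideal_mul I J)) (only parsing).
Notation powI I k := (ideal_set (ideal_pow I k)) (only parsing).

Section IdealBasics.
Variable R : comPzRingType.
Implicit Types (I J : set R) (x y : R).

Lemma id0 I : is_ideal I -> I 0. Proof. by case. Qed.

Lemma idD I x y : is_ideal I -> I x -> I y -> I (x + y).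
Proof. by case=> _ + _; apply. Qed.

Lemma idMl I a x : is_ideal I -> I x -> I (a * x).
Proof. by case=> _ _; apply. Qed.

Lemma idMr I a x : is_ideal I -> I x -> I (x * a).
Proof. by rewrite mulrC; exact: idMl. Qed.

Lemma idN I x : is_ideal I -> I x -> I (- x).
Proof. by move=> hI; rewrite -mulN1r; exact: idMl. Qed.

Lemma idB I x y : is_ideal I -> I x -> I y -> I (x - y).
Proof. by move=> hI Ix Iy; apply: idD => //; exact: idN. Qed.

Lemma idBC I x y : is_ideal I -> I (x - y) -> I (y - x).
Proof. by move=> hI Ixy; rewrite -opprB; exact: idN. Qed.

Lemma id_sum I n (F : nat -> R) : is_ideal I ->
  (forall i, (i < n)%N -> I (F i)) -> I (\sum_(i < n) F i).
Proof.
move=> hI IF; elim/big_ind: _ => [|x y|i _]; first exact: id0.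
  exact: idD.
exact: IF.
Qed.

Lemma id_addr I x y : is_ideal I -> I y -> I (x + y) -> I x.
Proof. by move=> hI Iy Ixy; rewrite -(addrK y x); exact: idB. Qed.

Lemma idT I : is_ideal I -> I 1 -> I = setT.
Proof.
by move=> hI I1; apply/seteqP; split=> // x _; rewrite -(mulr1 x); exact: idMl.
Qed.

Lemma is_ideal_gen (E : set R) : is_ideal (ideal_gen E).
Proof. exact: smallest_is_ideal. Qed.

Lemma sub_gen (E : set R) : E `<=` ideal_gen E.
Proof. exact: sub_gen_smallest. Qed.

Lemma gen_sub (E : set R) I : is_ideal I -> E `<=` I -> ideal_gen E `<=` I.
Proof. exact: smallest_sub. Qed.

Lemma gen_mono (E F : set R) : E `<=` F -> ideal_gen E `<=` ideal_gen F.
Proof.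
by move=> EF; apply: gen_sub => [|x /EF]; [exact: is_ideal_gen|exact: sub_gen].
Qed.

Lemma prime_is_ideal I : prime_ideal I -> is_ideal I. Proof. by case. Qed.

Lemma prime_mul I x y : prime_ideal I -> I (x * y) -> I x \/ I y.
Proof. by case=> _ _; apply. Qed.

Lemma prime_pow I x n : prime_ideal I -> I (x ^+ n) -> I x.
Proof.
move=> pI; elim: n => [|n IH]; first by case: pI.
by rewrite exprS => /(prime_mul pI)[].
Qed.

Lemma prime_or_split I : is_ideal I -> ~ I 1 ->
  prime_ideal I \/ exists x y, [/\ I (x * y), ~ I x & ~ I y].
Proof.
move=> hI I1.
have [pI|npI] := pselect (forall x y, I (x * y) -> I x \/ I y); [by left|right].
apply: contrapT => no; apply: npI => x y Ixy; apply: contrapT => /not_orP[Ix Iy].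
by apply: no; exists x, y.
Qed.

Definition span (s : seq R) : set R :=
  [set x | exists c : nat -> R, x = \sum_(i < size s) c i * s`_i].

Lemma is_ideal_span s : is_ideal (span s).
Proof.
split=> [|_ _ [c ->] [d ->]|a _ [c ->]].
- by exists (fun=> 0); rewrite big1 // => i _; rewrite mul0r.
- exists (fun i => c i + d i); rewrite -big_split.
  by apply: eq_bigr => i _; rewrite mulrDl.
- exists (fun i => a * c i); rewrite mulr_sumr.
  by apply: eq_bigr => i _; rewrite mulrA.
Qed.

Lemma mem_span s x : x \in s -> span s x.
Proof.
move=> xs; exists (fun i => (i == index x s)%:R).
have xi : (index x s < size s)%N by rewrite index_mem.
rewrite (bigD1 (Ordinal xi)) //= eqxx mul1r nth_index // big1 ?addr0 // => i.
by rewrite -val_eqE /= => /negbTE ->; rewrite mul0r.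
Qed.

Lemma span_sub s I : is_ideal I -> (forall x, x \in s -> I x) -> span s `<=` I.
Proof.
move=> hI sI _ [c ->]; apply: (id_sum (F := fun i => c i * s`_i) hI) => i ils.
exact: idMl hI (sI _ (mem_nth 0 ils)).
Qed.

Lemma gen_span s : ideal_gen [set` s] = span s :> set R.
Proof.
apply/seteqP; split.
  by apply: gen_sub => [|x]; [exact: is_ideal_span|exact: mem_span].
by apply: span_sub => [|x xs]; [exact: is_ideal_gen|exact: sub_gen].
Qed.

Definition finitely_generated I := exists s, I = span s.

Lemma noetherianP : noetherian R <-> forall I, is_ideal I -> finitely_generated I.
Proof.
split=> [nR I hI|nR J]; last first.
  by have [s sE] := nR _ (ideal_setP J); exists s; rewrite gen_span.
by have [s] := nR (Ideal hI); rewrite gen_span; exists s.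
Qed.

Lemma noeth_fg I : noetherian R -> is_ideal I -> finitely_generated I.
Proof. by move/noetherianP; apply. Qed.

Definition adjoin I a : set R := [set x | exists i r, I i /\ x = i + r * a].

Lemma is_ideal_adjoin I a : is_ideal I -> is_ideal (adjoin I a).
Proof.
move=> hI; split=> [|_ _ [i [r [Ii ->]]] [j [s [Ij ->]]]|b _ [i [r [Ii ->]]]].
- by exists 0, 0; rewrite mul0r addr0; split=> //; exact: id0.
- by exists (i + j), (r + s); split; [exact: idD|ring].
- by exists (b * i), (b * r); split; [exact: idMl|ring].
Qed.

Lemma sub_adjoin I a : I `<=` adjoin I a.
Proof. by move=> x Ix; exists x, 0; rewrite mul0r addr0. Qed.

Lemma mem_adjoin I a : is_ideal I -> adjoin I a a.
Proof. by move=> hI; exists 0, 1; rewrite mul1r add0r; split=> //; exact: id0. Qed.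

Lemma adjoin_sub I J a : is_ideal J -> I `<=` J -> J a -> adjoin I a `<=` J.
Proof. by move=> hJ IJ Ja _ [i [r [/IJ Ji ->]]]; apply: idD => //; exact: idMl. Qed.

Lemma adjoin_proper I a : is_ideal I -> ~ I a -> I `<` adjoin I a.
Proof.
move=> hI Ia; split; first exact: sub_adjoin.
by move/(_ _ (mem_adjoin a hI)).
Qed.

Definition colon I a : set R := [set x | I (x * a)].

Lemma is_ideal_colon I a : is_ideal I -> is_ideal (colon I a).
Proof.
move=> hI; split=> [|x y Ix Iy|b x Ix]; rewrite /colon /=.
- by rewrite mul0r; exact: id0.
- by rewrite mulrDl; exact: idD.
- by rewrite -mulrA; exact: idMl.
Qed.

Lemma chain_mono (A : nat -> set R) : (forall n, A n `<=` A n.+1) ->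
  forall m n, (m <= n)%N -> A m `<=` A n.
Proof.
move=> Ainc m; elim=> [|n IH]; first by rewrite leqn0 => /eqP ->.
rewrite leq_eqVlt => /predU1P[-> //|/IH Amn].
exact: subset_trans Amn (Ainc n).
Qed.

Lemma is_ideal_bigcup (A : nat -> set R) : (forall n, is_ideal (A n)) ->
  (forall n, A n `<=` A n.+1) -> is_ideal (\bigcup_n A n).
Proof.
move=> hA Ainc.
have Amono := chain_mono Ainc.
split=> [|x y [m _ Ax] [n _ Ay]|a x [n _ Ax]].
- by exists 0%N => //; exact: id0.
- exists (maxn m n) => //; apply: idD => //.
    exact: Amono (leq_maxl m n) _ Ax.
  exact: Amono (leq_maxr m n) _ Ay.
- by exists n => //; exact: idMl.
Qed.

(** Stated for a single chain, because [fg_above_step] applies it in a ring that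
    is not yet known to be Noetherian. *)
Lemma chain_stable (A : nat -> set R) : (forall n, is_ideal (A n)) ->
  (forall n, A n `<=` A n.+1) -> finitely_generated (\bigcup_n A n) ->
  exists n, forall m, A m `<=` A n.
Proof.
move=> hA Ainc [s sE].
have Amono := chain_mono Ainc.
have [n sAn] : exists n, forall x, x \in s -> A n x.
  have : forall x, x \in s -> exists n, A n x.
    by move=> x /mem_span; rewrite -sE => -[n _ Ax]; exists n.
  elim: (s) => [|x s' IH] sA; first by exists 0%N.
  have [|n An] := IH; first by move=> y ys; apply: sA; rewrite inE ys orbT.
  have [|m Am] := sA x; first by rewrite inE eqxx.
  exists (maxn m n) => y; rewrite inE => /predU1P[->|/An Ay].
    exact: Amono (leq_maxl m n) _ Am.
  exact: Amono (leq_maxr m n) _ Ay.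
exists n => m x Ax; apply: (span_sub (hA n) sAn).
by rewrite -sE; exists m.
Qed.

Lemma noeth_ind (P : set R -> Prop) : noetherian R ->
  (forall I, is_ideal I ->
     (forall J, is_ideal J -> I `<` J -> P J) -> P I) ->
  forall I, is_ideal I -> P I.
Proof.
move=> nR step I0 hI0; apply: contrapT => PI0.
pose bad := {I : set R | is_ideal I /\ ~ P I}.
have /choice[f fP] : forall I : bad, exists J : bad, sval I `<` sval J.
  move=> [I [hI nPI]]; apply: contrapT => noJ; apply: (nPI).
  apply: step => // J hJ IJ; apply: contrapT => nPJ.
  by apply: noJ; exists (exist _ J (conj hJ nPJ)).
pose A n := sval (iter n f (exist _ I0 (conj hI0 PI0))).
have hA n : is_ideal (A n) by rewrite /A; case: (iter n f _) => J [].
have Ainc n : A n `<` A n.+1 by exact: fP.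
have As n : A n `<=` A n.+1 by case: (Ainc n).
have [n nmax] := chain_stable hA As (noeth_fg nR (is_ideal_bigcup hA As)).
by have [_] := Ainc n; apply; exact: nmax.
Qed.

Lemma noeth_max (P : set R -> Prop) I0 : noetherian R -> is_ideal I0 -> P I0 ->
  exists I, [/\ is_ideal I, P I, I0 `<=` I &
    forall J, is_ideal J -> P J -> I `<=` J -> J `<=` I].
Proof.
move=> nR hI0 PI0; move: I0 hI0 PI0.
apply: (noeth_ind (P := fun I0 => P I0 -> exists I, [/\ is_ideal I, P I,
  I0 `<=` I & forall J, is_ideal J -> P J -> I `<=` J -> J `<=` I]) nR).
move=> I hI IH PI.
have [[J [hJ PJ IJ]]|noJ] :=
    pselect (exists J, [/\ is_ideal J, P J & I `<` J]); last first.
  exists I; split=> // J hJ PJ IJ; apply: contrapT => nJI.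
  by apply: noJ; exists J.
have [K [hK PK JK Kmax]] := IH J hJ IJ PJ; exists K; split=> //.
by apply: subset_trans JK; case: IJ.
Qed.

Lemma noeth_stable (A : nat -> set R) : noetherian R ->
  (forall n, is_ideal (A n)) -> (forall n, A n `<=` A n.+1) ->
  exists n, forall m, A m `<=` A n.
Proof.
move=> nR hA Ainc; apply: chain_stable => //.
exact: noeth_fg nR (is_ideal_bigcup hA Ainc).
Qed.

(** ** Products and powers of ideals *)

Lemma is_ideal_mul (I J : set R) : is_ideal (mulI I J).
Proof. exact: is_ideal_gen. Qed.

Lemma mem_mul (I J : set R) x y : I x -> J y -> mulI I J (x * y).
Proof. by move=> Ix Jy; apply: sub_gen; exists x => //; exists y. Qed.

Lemma mul_sub (I J K : set R) : is_ideal K ->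
  (forall x y, I x -> J y -> K (x * y)) -> mulI I J `<=` K.
Proof. by move=> hK IJK; apply: gen_sub => // _ [x Ix [y Jy <-]]; exact: IJK. Qed.

Lemma is_ideal_pow (I : ideal R) k : is_ideal (powI I k).
Proof. exact: ideal_setP. Qed.

Lemma pow_add (I : ideal R) m n x y : powI I m x -> powI I n y ->
  powI I (m + n) (x * y).
Proof.
move=> + Iy; elim: m x => [|m IH] x.
  by move=> _; apply: idMl => //; exact: is_ideal_pow.
move: x; apply: (mul_sub (K := fun x => powI I (m.+1 + n) (x * y))).
  by apply: (is_ideal_colon (I := powI I (m.+1 + n)) y); exact: is_ideal_pow.
by move=> a b Ia Ib; rewrite -mulrA addSn; apply: mem_mul => //; exact: IH.
Qed.

Lemma pow_split (I : ideal R) m n :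
  powI I (m + n) `<=` mulI (powI I m) (powI I n).
Proof.
elim: m => [|m IH]; first by move=> z Iz; rewrite -(mul1r z); exact: mem_mul.
apply: mul_sub => [|a b Ia /IH]; first exact: is_ideal_mul.
rewrite mulrC; move: b.
apply: (mul_sub (is_ideal_colon a (is_ideal_mul _ _))) => c d Ic Id.
rewrite /colon /= mulrC mulrA; apply: mem_mul => //; exact: mem_mul.
Qed.

Lemma pow_anti (I : ideal R) m n : (m <= n)%N -> powI I n `<=` powI I m.
Proof.
elim: n => [|n IH]; first by rewrite leqn0 => /eqP ->.
rewrite leq_eqVlt => /predU1P[-> //|/IH mn].
by apply: subset_trans mn; exact: @ideal_powS_sub _ _.
Qed.

Lemma pow_mono (I J : ideal R) k : I `<=` J -> powI I k `<=` powI J k.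
Proof.
move=> IJ; elim: k => // k IH; apply: mul_sub; first exact: is_ideal_mul.
by move=> x y /IJ Jx /IH Jy; exact: mem_mul.
Qed.

Lemma pow1 (I : ideal R) : powI I 1 = I :> set R.
Proof.
have hI := ideal_setP I; apply/seteqP; split.
  by apply: mul_sub => // x y Ix _; exact: idMr.
by move=> x Ix; rewrite -(mulr1 x); exact: mem_mul.
Qed.

Lemma mem_pow (I : ideal R) k x : ideal_set I x -> powI I k (x ^+ k).
Proof. by move=> Ix; elim: k => // k IH; rewrite exprS; exact: mem_mul. Qed.

Lemma mul_spanP (I : set R) s x : is_ideal I -> mulI I (span s) x ->
  exists c : nat -> R, (forall i, I (c i)) /\ x = \sum_(i < size s) c i * s`_i.
Proof.
move=> hI; move: x; apply: (mul_sub (K := fun x => exists c : nat -> R,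
   (forall i, I (c i)) /\ x = \sum_(i < size s) c i * s`_i)).
  split=> [|_ _ [c [Ic ->]] [d [Id ->]]|a _ [c [Ic ->]]].
  - exists (fun=> 0); split=> [_|]; first exact: id0.
    by rewrite big1 // => i _; rewrite mul0r.
  - exists (fun i => c i + d i); split=> [i|]; first exact: idD.
    by rewrite -big_split; apply: eq_bigr => i _; rewrite mulrDl.
  - exists (fun i => a * c i); split=> [i|]; first exact: idMl.
    by rewrite mulr_sumr; apply: eq_bigr => i _; rewrite mulrA.
move=> a _ Ia [c ->]; exists (fun i => a * c i); split=> [i|]; first exact: idMr.
by rewrite mulr_sumr; apply: eq_bigr => i _; rewrite mulrA.
Qed.

End IdealBasics.

(** * Artin-Rees, Nakayama and Krull intersection *)

Section Noetherian.
Variable R : comPzRingType.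
Hypothesis nR : noetherian R.
Implicit Types (I J : set R) (x y : R).

Lemma pow_sub_of_radical (J : ideal R) I : is_ideal I ->
  (forall r, ideal_set J r -> exists n, I (r ^+ n)) ->
  exists N, powI J N `<=` I.
Proof.
move: I; apply: (noeth_ind nR) => I hI IH Jn.
have [I1|nI1] := pselect (I 1); first by exists 0%N; rewrite (idT hI I1).
have [pI|[x [y [Ixy Ix Iy]]]] := prime_or_split hI nI1.
  by exists 1%N; rewrite pow1 => x /Jn[n]; exact: prime_pow.
have adj a : ~ I a -> exists N, powI J N `<=` adjoin I a.
  move=> Ia; apply: IH; [exact: is_ideal_adjoin|exact: adjoin_proper|].
  by move=> r /Jn[n Irn]; exists n; exact: sub_adjoin.
have [m Jm] := adj x Ix; have [n Jmn] := adj y Iy.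
have mulIn a b : adjoin I x a -> adjoin I y b -> I (a * b).
  move=> [i [r [Ii ->]]] [j [s [Ij ->]]].
  have -> : (i + r * x) * (j + s * y) =
     (j + s * y) * i + ((r * x) * j + r * s * (x * y)) by ring.
  by apply: idD => //; [|apply: idD => //]; exact: idMl.
exists (m + n)%N.
apply: subset_trans (@pow_split _ J m n) _; apply: mul_sub => // a b /Jm + /Jmn.
exact: mulIn.
Qed.

(** A weak form of the Artin-Rees lemma, with no control on the exponent [N].
    Take [C] maximal among the ideals over [L] that meet [A] inside [L]. For [r]
    in [J], the chain of the ideals [C : r ^+ n] stops, and then [C + (r ^+ n)]
    still meets [A] inside [L], so that [r ^+ n] is in [C]. *)
Lemma artin_rees (J : ideal R) (A L : set R) : is_ideal L -> is_ideal A ->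
  (forall r, ideal_set J r -> exists l, forall x, A x -> L (r ^+ l * x)) ->
  exists N, forall x y, L x -> powI J N y -> A (x + y) -> L (x + y).
Proof.
move=> hL hA JAL.
have [|C [hC CA LC Cmax]] := noeth_max
   (P := fun C => forall x, C x -> A x -> L x) nR hL; first by [].
have [|N JN] := @pow_sub_of_radical J C hC.
- move=> r /JAL[l rA].
  have [||n nst] := @noeth_stable R (fun n => colon C (r ^+ n)) nR.
  + by move=> n; exact: is_ideal_colon.
  + by move=> n x; rewrite /colon /= exprS mulrCA; exact: idMl.
  pose k := maxn l n; exists k.
  have kst x : C (x * r ^+ (k + k)) -> C (x * r ^+ k).
    move=> Cx; have Cxn : C (x * r ^+ n) := nst _ _ Cx.
    by rewrite -(subnK (leq_maxr l n) : (k - n + n = k)%N) exprD mulrCA; exact: idMl.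
  have krA x : A x -> L (r ^+ k * x).
    move=> /rA; rewrite -(subnK (leq_maxl l n) : (k - l + l = k)%N) exprD -mulrA.
    exact: idMl.
  suff : adjoin C (r ^+ k) `<=` C by apply; exact: mem_adjoin.
  apply: Cmax => [||x Cx]; [exact: is_ideal_adjoin| |exact: sub_adjoin].
  move=> _ [c [s [Cc ->]]] Acs; apply: CA => //; apply: idD => //; apply: kst.
  have /LC := krA _ Acs; rewrite mulrDr => Crc.
  rewrite exprD mulrA mulrC; apply: id_addr (idMl (r ^+ k) hC Cc) _ => //.
  by rewrite addrC.
exists N => x y Lx Jy Axy; apply: CA => //.
by apply: idD => //; [exact: LC|exact: JN].
Qed.

(** Nakayama's lemma for the localizations at [Q], with saturation in place of
    localization. Among the saturated ideals over [Y] that do not contain [X], let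
    [Z] be maximal. It absorbs [Q X]: for [x] in [X] outside [Z], the saturation
    of [Z + Q x] does not contain [x], hence is [Z]. But then [X] is in [Z]. *)
Lemma nakayama (Q X Y : set R) : prime_ideal Q -> is_ideal X -> is_ideal Y ->
  (forall t x, ~ Q t -> Y (t * x) -> Y x) ->
  (forall x, X x -> exists t y w,
     [/\ ~ Q t, Y y, mulI Q X w & t * x = y + w]) ->
  X `<=` Y.
Proof.
move=> pQ hX hY satY XYQ; apply: contrapT => nXY.
pose sat Z := forall t x, ~ Q t -> Z (t * x) -> Z x.
have hQ := prime_is_ideal pQ.
have [|Z [hZ [satZ XZ] YZ Zmax]] := noeth_max
   (P := fun Z => sat Z /\ ~ (X `<=` Z)) nR hY; first by split.
suff QXZ : mulI Q X `<=` Z.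
  apply: XZ => x /XYQ[t [y [w [Qt Yy Qw e]]]]; apply: (satZ t) => //.
  by rewrite e; apply: idD => //; [exact: YZ|exact: QXZ].
apply: mul_sub => // q x Qq Xx; have [Zx|nZx] := pselect (Z x); first exact: idMl.
(* the saturation of Z + Q x *)
pose Z' := [set u | exists t z q', [/\ ~ Q t, Z z, Q q' & t * u = z + q' * x]].
have hZ' : is_ideal Z'.
  split=> [|u v [t [z [p [Qt Zz Qp e]]]] [t' [z' [p' [Qt' Zz' Qp' e']]]]|
           a u [t [z [p [Qt Zz Qp e]]]]].
  - exists 1, 0, 0; split; [by case: pQ|exact: id0|exact: id0|ring].
  - exists (t * t'), (t' * z + t * z'), (t' * p + t * p'); split.
    + by move/(prime_mul pQ) => -[].
    + by apply: idD => //; exact: idMl.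
    + by apply: idD => //; exact: idMl.
    + have -> : t * t' * (u + v) = t' * (t * u) + t * (t' * v) by ring.
      by rewrite e e'; ring.
  - exists t, (a * z), (a * p); split=> //; [exact: idMl|exact: idMl|].
    have -> : t * (a * u) = a * (t * u) by ring.
    by rewrite e; ring.
have ZZ' : Z `<=` Z'.
  move=> u Zu; exists 1, u, 0; split=> //; [by case: pQ|exact: id0|ring].
have satZ' : sat Z'.
  move=> t u Qt [t' [z [p [Qt' Zz Qp e]]]]; exists (t' * t), z, p; split=> //.
    by move/(prime_mul pQ) => -[].
  by rewrite -mulrA.
have [XZ'|nXZ'] := pselect (X `<=` Z').
  have [t [z [p [Qt Zz Qp e]]]] := XZ' _ Xx; exfalso; apply: nZx.
  apply: (satZ (t - p)) => [Qtp|]; first by apply: Qt; rewrite -(subrK p t); exact: idD.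
  by rewrite mulrBl e addrK.
apply: (Zmax Z') => //; exists 1, 0, q; split=> //; [by case: pQ|exact: id0|ring].
Qed.

End Noetherian.

Section LocalRing.
Variables (R : comPzRingType) (M : ideal R).
Hypothesis hR : local_ring M.

Let nR : noetherian R. Proof. by case: hR. Qed.
Let hM : is_ideal M. Proof. exact: ideal_setP. Qed.

Lemma local_not1 : ~ ideal_set M 1.
Proof. by case: hR => _ [_ nT _] _ M1; apply: nT; exact: idT. Qed.

Lemma local_unit x : ~ ideal_set M x -> exists y, x * y = 1.
Proof.
move=> Mx; apply: contrapT => nux.
pose X := [set x * y | y in [set: R]].
have hX : is_ideal X.
  split=> [|_ _ [y _ <-] [z _ <-]|a _ [y _ <-]].
  - by exists 0 => //; rewrite mulr0.
  - by exists (y + z) => //; rewrite mulrDr.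
  - by exists (a * y) => //; rewrite mulrCA.
have [|N [hN N1 XN Nmax]] := noeth_max (P := fun I => ~ I 1) nR hX.
  by move=> [y _ e]; apply: nux; exists y.
have mN : maximal_ideal N.
  split=> // [NT|J hJ NJ]; first by apply: N1; rewrite NT.
  have [J1|nJ1] := pselect (J 1); [right; exact: idT|left].
  by apply/seteqP; split=> //; exact: Nmax.
case: hR => _ _ /(_ _ mN) NM; apply: Mx; rewrite -NM; apply: XN.
by exists 1 => //; rewrite mulr1.
Qed.

Lemma local_proper_sub I : is_ideal I -> ~ I 1 -> I `<=` M.
Proof.
move=> hI I1 x Ix; apply: contrapT => /local_unit[y xy1]; apply: I1.
by rewrite -xy1; exact: idMr.
Qed.

Lemma local_prime : prime_ideal M.
Proof.
split=> //; first exact: local_not1.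
move=> x y Mxy; have [|/local_unit[z xz1]] := pselect (ideal_set M x); first by left.
by right; rewrite -(mul1r y) -xz1 mulrAC; exact: idMr.
Qed.

(** Krull's intersection theorem for [R / B]: the intersection [X] of the ideals
    [B + J ^ k] is contained in [B + J X] by the Artin-Rees lemma, and then in [B]
    by Nakayama's lemma. *)
Lemma krull (J : ideal R) B x : J `<=` M -> is_ideal B ->
  (forall k, exists2 b, B b & powI J k (x - b)) -> B x.
Proof.
move=> JM hB xB.
pose X := [set x : R | forall k, exists2 b, B b & powI J k (x - b)].
have hX : is_ideal X.
  split=> [k|u v Xu Xv k|a u Xu k].
  - by exists 0; [exact: id0|rewrite subr0; exact: id0 (is_ideal_pow _ _)].
  - have [[b Bb Jb] [c Bc Jc]] := (Xu k, Xv k); exists (b + c); first exact: idD.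
    by rewrite opprD addrACA; apply: idD => //; exact: is_ideal_pow.
  - have [b Bb Jb] := Xu k; exists (a * b); first exact: idMl.
    by rewrite -mulrBr; apply: idMl => //; exact: is_ideal_pow.
pose L := [set u | exists b w, [/\ B b, mulI J X w & u = b + w]].
have hL : is_ideal L.
  have hJX := is_ideal_mul J X.
  split=> [|_ _ [b [w [Bb Jw ->]]] [c [v [Bc Jv ->]]]|a _ [b [w [Bb Jw ->]]]].
  - by exists 0, 0; rewrite addr0; split=> //; exact: id0.
  - by exists (b + c), (w + v); rewrite addrACA; split=> //; [exact: (idD hB)|exact: (idD hJX)].
  - by exists (a * b), (a * w); rewrite -mulrDr; split=> //; [exact: (idMl _ hB)|exact: (idMl _ hJX)].
have [|N NXL] := @artin_rees R nR J X L hL hX.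
  move=> r Jr; exists 1%N => y Xy; exists 0, (r ^+ 1 * y); rewrite add0r.
  by split=> //; [exact: id0|rewrite expr1; exact: mem_mul].
have XL : X `<=` L.
  move=> y Xy; have [b Bb Jb] := Xy N; rewrite -(subrK b y) addrC.
  apply: NXL => //; last by rewrite addrC subrK.
  by exists b, 0; rewrite addr0; split=> //; exact: id0 (is_ideal_mul _ _).
apply: (nakayama nR local_prime hX hB) xB => [t y /local_unit[z tz1] Bty|y Xy].
  by rewrite -(mul1r y) -tz1 mulrAC; exact: idMr.
have [b [w [Bb Jw ->]]] := XL _ Xy; exists 1, b, w; split=> //.
- exact: local_not1.
- by apply: gen_mono Jw => _ [u /JM Mu [v Xv <-]]; exists u => //; exists v.
- by rewrite mul1r.
Qed.

End LocalRing.

Lemma local_ringP (R : comPzRingType) (M : ideal R) : noetherian R ->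
  ~ ideal_set M 1 -> (forall x, ~ ideal_set M x -> exists y, x * y = 1) ->
  local_ring M.
Proof.
move=> nR M1 Mu; have hM := ideal_setP M.
have sub J : is_ideal J -> ~ J 1 -> J `<=` M.
  move=> hJ J1 x Jx; apply: contrapT => /Mu[y xy]; apply: J1.
  by rewrite -xy; exact: idMr.
split=> //.
  split=> // [MT|J hJ MJ]; first by apply: M1; rewrite MT.
  have [J1|nJ1] := pselect (J 1); [right; exact: idT|left].
  by apply/seteqP; split=> //; exact: sub.
move=> J [hJ JT Jmax]; have J1 : ~ J 1 by move=> /(idT hJ).
have [//|MT] := Jmax M hM (sub J hJ J1); by case: M1; rewrite MT.
Qed.

(** * Adic completions *)

Section Extension.
Variables (R S : comPzRingType) (f : {rmorphism R -> S}).

Definition ext (I : set R) : ideal S := ideal_gen (f @` I).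

End Extension.

Notation extI f I := (ideal_set (ext f I)) (only parsing).

Section ExtensionTheory.
Variables (R S : comPzRingType) (f : {rmorphism R -> S}).
Implicit Types I : set R.

Lemma is_ideal_ext I : is_ideal (ext f I).
Proof. exact: is_ideal_gen. Qed.

Lemma mem_ext I x : I x -> extI f I (f x).
Proof. by move=> Ix; apply: sub_gen; exists x. Qed.

Lemma ext_sub I (K : set S) : is_ideal K -> (forall x, I x -> K (f x)) ->
  ext f I `<=` K.
Proof. by move=> hK IK; apply: gen_sub => // _ [x Ix <-]; exact: IK. Qed.

Lemma ext_mono I I' : I `<=` I' -> ext f I `<=` ext f I'.
Proof.
by move=> II'; apply: ext_sub => [|x /II']; [exact: is_ideal_ext|exact: mem_ext].
Qed.

Lemma is_ideal_preim (K : set S) : is_ideal K -> is_ideal (f @^-1` K).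
Proof.
move=> hK; split=> [|x y Kx Ky|a x Kx]; rewrite /preimage /=.
- by rewrite rmorph0; exact: id0.
- by rewrite rmorphD; exact: idD.
- by rewrite rmorphM; exact: idMl.
Qed.

Lemma prime_preim (Q : set S) : prime_ideal Q -> prime_ideal (f @^-1` Q).
Proof.
move=> pQ; split; first exact: is_ideal_preim (prime_is_ideal pQ).
  by rewrite /preimage /= rmorph1; case: pQ.
by move=> x y; rewrite /preimage /= rmorphM; exact: prime_mul.
Qed.

Lemma extP I x : is_ideal I -> extI f I x -> exists n (s : nat -> S) (a : nat -> R),
  (forall i, I (a i)) /\ x = \sum_(i < n) s i * f (a i).
Proof.
move=> hI; move: x; apply: (ext_sub (K := fun x => exists n (s : nat -> S) (a : nat -> R),
  (forall i, I (a i)) /\ x = \sum_(i < n) s i * f (a i))); last first.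
  move=> x Ix; exists 1%N, (fun=> 1), (fun=> x); split=> //.
  by rewrite big_ord1 mul1r.
split=> [|_ _ [n [s [a [Ia ->]]]] [m [t [b [Ib ->]]]]|c _ [n [s [a [Ia ->]]]]].
- exists 0%N, (fun=> 0), (fun=> 0); rewrite big_ord0; split=> // _; exact: id0.
- exists (n + m)%N, (fun i => if (i < n)%N then s i else t (i - n)%N),
     (fun i => if (i < n)%N then a i else b (i - n)%N); split=> [i|].
    by case: ifP.
  rewrite big_split_ord /=; congr (_ + _); apply: eq_bigr => i _ /=.
    by rewrite ltn_ord.
  by rewrite ltnNge leq_addr /= addKn.
- exists n, (fun i => c * s i), a; split=> //; rewrite mulr_sumr.
  by apply: eq_bigr => i _; rewrite mulrA.
Qed.

Lemma ext_span s : extI f (span s) = span (map f s).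
Proof.
apply/seteqP; split.
  apply: ext_sub; first exact: is_ideal_span.
  move=> _ [c ->]; rewrite rmorph_sum; exists (fun i => f (c i)).
  rewrite size_map; apply: eq_bigr => i _.
  by rewrite rmorphM (nth_map 0).
apply: span_sub; first exact: is_ideal_ext.
by move=> _ /mapP[x xs ->]; apply: mem_ext; exact: mem_span.
Qed.

Lemma ext_mul (I I' : set R) x y : extI f I x -> extI f I' y ->
  extI f (mulI I I') (x * y).
Proof.
have hK := is_ideal_ext (mulI I I').
move=> Ix I'y; move: x Ix; apply: (ext_sub (is_ideal_colon y hK)) => a Ia.
rewrite /colon /= mulrC; move: y I'y.
apply: (ext_sub (is_ideal_colon _ hK)) => b I'b.
by rewrite /colon /= mulrC -rmorphM; apply: mem_ext; exact: mem_mul.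
Qed.

Lemma ext_pow (I : ideal R) k : powI (ext f I) k = extI f (powI I k).
Proof.
elim: k => [|k IH].
  apply/seteqP; split=> // x _; rewrite -(mulr1 x) -(rmorph1 f).
  by apply: (idMl _ (is_ideal_ext _)); exact: mem_ext.
apply/seteqP; split.
  apply: mul_sub; first exact: is_ideal_ext.
  by move=> x y Ix; rewrite IH; exact: ext_mul.
apply: ext_sub; first exact: is_ideal_pow.
apply: (mul_sub (K := f @^-1` powI (ext f I) k.+1)) => [|x y Ix Iy].
  exact: is_ideal_preim (is_ideal_pow _ _).
rewrite /preimage /= rmorphM; apply: mem_mul; first exact: mem_ext.
by rewrite IH; exact: mem_ext.
Qed.

End ExtensionTheory.

(** The [J]-adic completion of [R], up to isomorphism. The topology of [S] is the
    adic one of the ideal [J S], and [compl_contract] says that it induces the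
    [J]-adic topology on [R]. *)
Record is_completion (R S : comPzRingType) (f : {rmorphism R -> S})
    (J : ideal R) : Prop := IsCompletion {
  compl_dense : forall s k, exists r, powI (ext f J) k (s - f r) ;
  compl_contract : forall r k, powI (ext f J) k (f r) -> powI J k r ;
  compl_sep : forall s, (forall k, powI (ext f J) k s) -> s = 0 ;
  compl_lim : forall u : nat -> S,
    (forall k, powI (ext f J) k (u k.+1 - u k)) ->
    exists l, forall k, powI (ext f J) k (l - u k) }.

Section CompletionTheory.
Variables (R S : comPzRingType) (f : {rmorphism R -> S}) (J : ideal R).
Hypothesis cS : is_completion f J.

Notation E k := (powI (ext f J) k).
Let hE k : is_ideal (E k). Proof. exact: is_ideal_pow. Qed.

Lemma ext_approx (A : set R) k x : is_ideal A -> extI f A x ->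
  exists2 a, A a & E k (x - f a).
Proof.
move=> hA; move: x; apply: (ext_sub (K := fun x => exists2 a, A a & E k (x - f a))).
  split=> [|x y [a Aa Ea] [b Ab Eb]|s x [a Aa Ea]].
  - by exists 0; [exact: id0|rewrite rmorph0 subr0; exact: id0 (hE k)].
  - exists (a + b); first exact: idD.
    by rewrite rmorphD opprD addrACA; exact: (idD (hE k)).
  - have [r Er] := compl_dense cS s k; exists (r * a); first exact: idMl.
    rewrite rmorphM.
    have -> : s * x - f r * f a = s * (x - f a) + f a * (s - f r) by ring.
    by apply: (idD (hE k)); exact: (idMl _ (hE k)).
by move=> a Aa; exists a => //; rewrite subrr; exact: id0 (hE k).
Qed.

Lemma ext_contract_approx (A : set R) k r e : is_ideal A ->
  extI f A (f r - e) -> E k e -> exists2 a, A a & powI J k (r - a).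
Proof.
move=> hA Ar Ee; have [a Aa Ea] := ext_approx k hA Ar; exists a => //.
apply: (compl_contract cS); rewrite rmorphB.
have -> : f r - f a = (f r - e - f a) + e by ring.
exact: (idD (hE k)).
Qed.

Lemma compl_series (u : nat -> S) : (forall k, E k (u k)) ->
  exists l, forall k, E k (l - \sum_(i < k) u i).
Proof.
move=> Eu; apply: (compl_lim cS) => k.
by rewrite big_ord_recr /= addrAC subrr add0r.
Qed.

Lemma compl_eq x y : (forall k, E k (x - y)) -> x = y.
Proof. by move=> Exy; apply/eqP; rewrite -subr_eq0; apply/eqP/(compl_sep cS). Qed.

(** Division with remainder repeated: the coefficients are the limits of the
    partial sums in powers of [y]. *)
Lemma series_division (y : S) m (h : nat -> S) (X : set S) : extI f J y ->
  (forall x, X x -> exists (c : nat -> S) x', X x' /\ x = \sum_(i < m) c i * h i + y * x') ->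
  forall x, X x -> exists c : nat -> S, x = \sum_(i < m) c i * h i.
Proof.
move=> Jy Xdiv x Xx.
have /choice[g gP] : forall x, exists cx : (nat -> S) * S, X x ->
    X cx.2 /\ x = \sum_(i < m) cx.1 i * h i + y * cx.2.
  move=> z; have [/Xdiv[c [z' [Xz' e]]]|nX] := pselect (X z); last by exists (fun=> 0, 0).
  by exists (c, z').
pose rest n := iter n (fun z => (g z).2) x.
have Xrest n : X (rest n) by elim: n => //= n /gP[].
pose u i n := y ^+ n * (g (rest n)).1 i.
have xE p : x = \sum_(i < m) (\sum_(j < p) u i j) * h i + y ^+ p * rest p.
  elim: p => [|p IH].
    by rewrite big1 ?add0r ?mul1r // => i _; rewrite big_ord0 mul0r.
  rewrite {1}IH {1}(gP _ (Xrest p)).2 mulrDr addrA mulr_sumr -big_split exprSr.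
  rewrite mulrA /=.
  congr (_ + _); apply: eq_bigr => i _.
  by rewrite big_ord_recr /= mulrDl mulrA.
have /choice[c cP] : forall i, exists l, forall k, E k (l - \sum_(j < k) u i j).
  by move=> i; apply: compl_series => k; apply: (idMr _ (hE k)); exact: mem_pow.
exists c; apply: compl_eq => p; rewrite {1}(xE p) addrAC -sumrB.
apply: (idD (hE p)); last by apply: (idMr _ (hE p)); exact: mem_pow.
apply: (id_sum (F := fun i => (\sum_(j < p) u i j) * h i - c i * h i) (hE p)) => i _.
by rewrite -mulrBl; apply: (idMr _ (hE p)); exact: (idBC (hE p)).
Qed.

Lemma adjoin_gens (B : set S) y : is_ideal B -> finitely_generated (adjoin B y) ->
  exists m (h : nat -> S), (forall i, B (h i)) /\
    forall x, adjoin B y x -> exists (c : nat -> S) x', x = \sum_(i < m) c i * h i + y * x'.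
Proof.
move=> hB [s sE].
have /choice[hr hrP] : forall i, exists hr : S * S, B hr.1 /\ s`_i = hr.1 + hr.2 * y.
  move=> i; have [si|si] := ltnP i (size s).
    have : adjoin B y s`_i by rewrite sE; apply: mem_span; exact: mem_nth.
    by move=> [b [r [Bb e]]]; exists (b, r).
  by exists (0, 0); rewrite nth_default // mul0r addr0; split=> //; exact: id0.
exists (size s), (fun i => (hr i).1); split=> [i|x]; first by case: (hrP i).
rewrite sE => -[c ->]; exists c, (\sum_(i < size s) c i * (hr i).2).
rewrite mulr_sumr -big_split; apply: eq_bigr => i _ /=.
by rewrite (hrP i).2; ring.
Qed.

(** The power-series analogue of Hilbert's basis theorem, one element [y] at a
    time: the ideals [(a : y ^+ n) + (y)] play the part of the ideals of leading
    coefficients. *)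
Lemma fg_above_step (A : set S) y : extI f J y ->
  (forall a, is_ideal a -> A `<=` a -> a y -> finitely_generated a) ->
  forall a, is_ideal a -> A `<=` a -> finitely_generated a.
Proof.
move=> Jy fgAy a ha Aa.
pose D n := adjoin (colon a (y ^+ n)) y.
have hC n : is_ideal (colon a (y ^+ n)) by exact: is_ideal_colon.
have hD n : is_ideal (D n) by exact: is_ideal_adjoin.
have Cinc n : colon a (y ^+ n) `<=` colon a (y ^+ n.+1).
  by move=> x ax; rewrite /colon /= exprS mulrCA; exact: idMl.
have Dinc n : D n `<=` D n.+1.
  apply: adjoin_sub => //; last exact: mem_adjoin.
  exact: subset_trans (Cinc n) (@sub_adjoin _ _ _).
have AC n : A `<=` colon a (y ^+ n).
  by move=> x /Aa ax; rewrite /colon /=; exact: idMr.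
have AD n : A `<=` D n by apply: subset_trans (AC n) _; exact: sub_adjoin.
have fgD n : finitely_generated (D n) by apply: fgAy => //; exact: mem_adjoin.
have [|n0 Dst] := chain_stable hD Dinc.
  apply: fgAy; first exact: is_ideal_bigcup.
  - by move=> x Ax; exists 0%N => //; exact: AD.
  - by exists 0%N => //; exact: mem_adjoin.
have gens n := adjoin_gens (hC n) (fgD n).
have top : exists s, (forall x, x \in s -> a x) /\
    forall x, a (x * y ^+ n0) -> span s (x * y ^+ n0).
  have [m [h [ah hP]]] := gens n0.
  exists (mkseq (fun i => h i * y ^+ n0) m); split=> [x|x ax].
    by move=> /mapP[i _ ->]; exact: ah.
  have [||c ->] := @series_division y m h
     [set z | exists p, a (z * y ^+ (p + n0))] Jy _ x; last 1 first.
  - rewrite mulr_suml; exists c; rewrite size_mkseq; apply: eq_bigr => i _.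
    by rewrite nth_mkseq // mulrA.
  - move=> z [p az]; have Dz : D n0 z by apply: (Dst (p + n0)%N); exact: sub_adjoin.
    have [c [z' e]] := hP _ Dz; exists c, z'; split=> //; exists p.+1.
    have -> : z' * y ^+ (p.+1 + n0) =
        z * y ^+ (p + n0) - y ^+ p * ((\sum_(i < m) c i * h i) * y ^+ n0).
      by rewrite e addSn exprS !exprD; ring.
    apply: idB => //; apply: idMl => //; rewrite mulr_suml.
    apply: (id_sum (F := fun i => c i * h i * y ^+ n0) ha) => i _.
    by rewrite -mulrA; apply: idMl => //; exact: ah.
  - by exists 0%N.
have down d n : (n + d = n0)%N -> exists s, (forall x, x \in s -> a x) /\
    forall x, a (x * y ^+ n) -> span s (x * y ^+ n).
  elim: d n => [|d IH] n; first by rewrite addn0 => ->.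
  rewrite addnS -addSn => /IH[s [sa sP]].
  have [m [h [ah hP]]] := gens n.
  exists (mkseq (fun i => h i * y ^+ n) m ++ s); split=> [x|x ax].
    by rewrite mem_cat => /orP[/mapP[i _ ->]|/sa//]; exact: ah.
  have [c [z e]] := hP _ (@sub_adjoin _ _ _ _ ax).
  pose w := \sum_(i < m) c i * h i * y ^+ n.
  have aw : a w.
    apply: (id_sum (F := fun i => c i * h i * y ^+ n) ha) => i _.
    by rewrite -mulrA; apply: idMl => //; exact: ah.
  have xE : x * y ^+ n = w + z * y ^+ n.+1.
    by rewrite e mulrDl /w -mulr_suml exprS; ring.
  have hs := is_ideal_span (mkseq (fun i => h i * y ^+ n) m ++ s).
  rewrite xE; apply: (idD hs).
    apply: (id_sum (F := fun i => c i * h i * y ^+ n) hs) => i im.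
    rewrite -mulrA; apply: (idMl _ hs); apply: mem_span.
    rewrite mem_cat; apply/orP; left; apply/mapP; exists i => //.
    by rewrite mem_iota.
  have : span s (z * y ^+ n.+1).
    by apply: sP; apply: (id_addr ha aw); rewrite addrC -xE.
  apply: span_sub => // v vs; apply: mem_span.
  by rewrite mem_cat vs orbT.
have [s [sa sP]] := down n0 0%N erefl.
exists s; apply/seteqP; split=> [x ax|]; last exact: span_sub.
by have := sP x; rewrite expr0 mulr1; apply.
Qed.

(** Downward induction on the number of generators of [J] that the ideals are
    required to contain: those over [J S] are extended from [R]. *)
Lemma completion_noetherian : noetherian R -> noetherian S.
Proof.
move=> nR; have [gs gE] := noeth_fg nR (ideal_setP J).
suff fg s2 s1 : s1 ++ s2 = gs -> forall a, is_ideal a ->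
    [set` map f s1] `<=` a -> finitely_generated a.
  by apply/noetherianP => a ha; exact: (fg gs [::]).
elim: s2 s1 => [|x s2 IH] s1 sE.
  rewrite cats0 in sE; subst s1 => a ha ga.
  have Ja : ext f J `<=` a.
    by rewrite gE ext_span; apply: span_sub.
  have [s aE] := noeth_fg nR (is_ideal_preim f ha).
  exists (map f s); rewrite -ext_span -aE; apply/seteqP; split; last first.
    exact: ext_sub.
  move=> z az; have [r] := compl_dense cS z 1; rewrite pow1 => Jzr.
  have afr : a (f r).
    by apply: (id_addr ha (Ja _ Jzr)); rewrite addrC subrK.
  rewrite -(subrK (f r) z); apply: (idD (is_ideal_ext f _)); last exact: mem_ext.
  apply: ext_mono Jzr => j Jj; apply: Ja; exact: mem_ext.
apply: (fg_above_step (y := f x)).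
  by apply: mem_ext; rewrite gE; apply: mem_span; rewrite -sE mem_cat inE eqxx orbT.
move=> a ha s1a ax; apply: (IH (rcons s1 x)) => //; first by rewrite cat_rcons.
move=> z /=; rewrite map_rcons mem_rcons inE => /predU1P[->//|zs]; exact: s1a.
Qed.

End CompletionTheory.

(** * The completion of a local ring: locality and flatness *)

(** By the equational criterion, this is flatness of [S] over [R]. *)
Definition equationally_flat (R S : comPzRingType) (f : {rmorphism R -> S}) :=
  forall n (r : nat -> R) (s : nat -> S), \sum_(i < n) f (r i) * s i = 0 ->
  exists m (d : nat -> nat -> R) (t : nat -> S),
    (forall i, (i < n)%N -> s i = \sum_(k < m) f (d i k) * t k) /\
    (forall k, (k < m)%N -> \sum_(i < n) r i * d i k = 0).

Section CompletionOfLocal.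
Variables (R S : comPzRingType) (f : {rmorphism R -> S}) (J M : ideal R).
Hypotheses (hR : local_ring M) (JM : J `<=` M) (cS : is_completion f J).

Notation E k := (powI (ext f J) k).
Let hE k : is_ideal (E k). Proof. exact: is_ideal_pow. Qed.
Let nR : noetherian R. Proof. by case: hR. Qed.
Let nS : noetherian S. Proof. exact: completion_noetherian cS nR. Qed.

Lemma ext_contract (A : set R) r : is_ideal A -> J `<=` A ->
  extI f A (f r) -> A r.
Proof.
move=> hA JA Ar; have [||a Aa] := ext_contract_approx cS (k := 1) (r := r) (e := 0) hA.
- by rewrite subr0.
- exact: id0 (hE 1).
by rewrite pow1 => /JA; rewrite -{2}(subrK a r) => /(idD hA); apply.
Qed.

(** The inverse is the geometric series. *)
Lemma compl_unit j : extI f J j -> exists y, (1 - j) * y = 1.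
Proof.
move=> Jj; have [|y yP] := compl_series cS (u := fun i => j ^+ i).
  by move=> k; exact: mem_pow.
exists y; apply: (compl_eq cS) => k.
have e : (1 - j) * \sum_(i < k) j ^+ i = 1 - j ^+ k.
  by rewrite -opprB mulNr -subrX1 opprB.
have -> : (1 - j) * y - 1 = (1 - j) * (y - \sum_(i < k) j ^+ i) - j ^+ k.
  by rewrite mulrBr e; ring.
apply: (idB (hE k)); last exact: mem_pow.
exact: (idMl _ (hE k)).
Qed.

Lemma ext_local : local_ring (ext f M).
Proof.
have N1 : ~ extI f M 1.
  rewrite -(rmorph1 f) => /(ext_contract (ideal_setP M) JM).
  exact: local_not1 hR.
apply: local_ringP => // x Nx.
have [r] := compl_dense cS x 1; rewrite pow1 => Jxr.
have /(local_unit hR)[u ru] : ~ ideal_set M r.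
  move=> Mr; apply: Nx; rewrite -(subrK (f r) x).
  by apply: (idD (is_ideal_ext f _)); [exact: ext_mono Jxr|exact: mem_ext].
have fru : f r * f u = 1 by rewrite -rmorphM ru rmorph1.
have [|y yP] := @compl_unit (- (f u * (x - f r))).
  by apply: (idN (is_ideal_ext f _)); exact: (idMl _ (is_ideal_ext f _)).
exists (f u * y); rewrite -yP opprK mulrBr [f u * f r]mulrC fru; ring.
Qed.

Lemma ext_pow_dense s k : exists r, powI (ext f M) k (s - f r).
Proof.
have [r Er] := compl_dense cS s k; exists r.
by apply: pow_mono Er; exact: ext_mono.
Qed.

Lemma ext_pow_contract r k : powI (ext f M) k (f r) -> powI M k r.
Proof.
rewrite ext_pow => Mr.
have [||a Ma Jra] :=
    ext_contract_approx cS (k := k) (r := r) (e := 0) (is_ideal_pow M k).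
- by rewrite subr0.
- exact: id0 (hE k).
by rewrite -(subrK a r); apply: (idD (is_ideal_pow M k)) => //; exact: pow_mono Jra.
Qed.

Lemma compl_inj : injective f.
Proof.
apply/raddf_inj => r fr0.
have h0 : is_ideal [set 0 : R].
  by split=> [|x y -> ->|a x ->] //=; rewrite ?addr0 ?mulr0.
apply: (krull hR JM h0) => k; exists 0 => //; rewrite subr0.
by apply: (compl_contract cS); rewrite fr0; exact: id0 (hE k).
Qed.

(** Extension of ideals commutes with colons: the Artin-Rees lemma turns an
    approximate solution of [r * s \in A] into an exact one nearby, and Krull's
    theorem in [S] passes to the limit. *)
Lemma ext_colon (A : set R) r s : is_ideal A ->
  extI f A (f r * s) -> extI f (colon A r) s.
Proof.
move=> hA Ars; have JN : ext f J `<=` ext f M by exact: ext_mono.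
apply: (krull ext_local JN (is_ideal_ext f _)) => l.
pose L := [set u | exists a x, [/\ A a, powI J l x & u = a + x * r]].
have hJl := is_ideal_pow J l.
have hL : is_ideal L.
  split=> [|_ _ [a [x [Aa Jx ->]]] [b [y [Ab Jy ->]]]|c _ [a [x [Aa Jx ->]]]].
  - by exists 0, 0; rewrite mul0r addr0; split=> //; [exact: id0|exact: id0 hJl].
  - by exists (a + b), (x + y); split; [exact: idD|exact: (idD hJl)|ring].
  - by exists (c * a), (c * x); split; [exact: idMl|exact: (idMl _ hJl)|ring].
have [|N NL] := artin_rees nR (J := J) hL (is_ideal_adjoin r hA).
  move=> q Jq; exists l => _ [a [c [Aa ->]]].
  exists (q ^+ l * a), (q ^+ l * c); split; [exact: idMl| |ring].
  by apply: (idMr _ hJl); exact: mem_pow.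
have [r' Er'] := compl_dense cS s (maxn N l).
have [||a Aa Ja] := ext_contract_approx cS (k := maxn N l) (r := r' * r)
    (e := - (f r * (s - f r'))) hA.
- by rewrite opprK rmorphM mulrBr mulrC addrC subrK.
- by apply: (idN (hE _)); exact: (idMl _ (hE _)).
have [|||b [x [Ab Jx e]]] := NL a (r' * r - a).
- by exists a, 0; rewrite mul0r addr0; split=> //; exact: id0 hJl.
- by apply: pow_anti Ja; exact: leq_maxl.
- by rewrite addrC subrK; exists 0, r'; rewrite add0r; split=> //; exact: id0.
exists (f (r' - x)).
  apply: mem_ext; rewrite /colon /= mulrBl.
  by have -> : r' * r = b + x * r; [rewrite -e addrC subrK|rewrite addrK].
have -> : s - f (r' - x) = (s - f r') + f x by rewrite rmorphB; ring.
apply: (idD (hE l)); first by apply: pow_anti Er'; exact: leq_maxr.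
by rewrite ext_pow; exact: mem_ext.
Qed.

(** Induction on the number of terms. The last [s n] is in the extension of the
    ideal of those [c] for which [c * r n] is a combination of the other
    coefficients; each such [c] gives a relation in [R], and subtracting multiples
    of these relations leaves a shorter one. *)
Lemma completion_flat : equationally_flat f.
Proof.
elim=> [|n IH] r s; first by exists 0%N, (fun _ _ => 0), (fun=> 0); split.
rewrite big_ord_recr /= => rs0.
have hA := is_ideal_span (mkseq r n).
have : extI f (colon (span (mkseq r n)) (r n)) (s n).
  apply: ext_colon => //; rewrite -[f _ * _]opprK -(addr0_eq rs0) opprK.
  apply: (idN (is_ideal_ext f _)).
  apply: (id_sum (F := fun i => f (r i) * s i) (is_ideal_ext f _)) => i ni.
  apply: (idMr _ (is_ideal_ext f _)); apply: mem_ext; apply: mem_span.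
  by apply/mapP; exists i => //; rewrite mem_iota.
move=> /(extP (is_ideal_colon (r n) hA))[p [u [c [cP sn]]]].
have /choice[e eP] : forall j, exists e : nat -> R, c j * r n = \sum_(i < n) e i * r i.
  move=> j; have [e ->] := cP j; rewrite size_mkseq; exists e.
  by apply: eq_bigr => i _; rewrite nth_mkseq.
have [|m [d [t [s'E rd0]]]] := IH r (fun i => s i + \sum_(j < p) f (e j i) * u j).
  under eq_bigr do rewrite mulrDr.
  rewrite big_split /=; have -> : \sum_(i < n) f (r i) * (\sum_(j < p) f (e j i) * u j) =
      f (r n) * s n; last exact: rs0.
  under eq_bigr do rewrite mulr_sumr.
  rewrite exchange_big sn mulr_sumr; apply: eq_bigr => j _ /=.
  rewrite mulrCA -rmorphM [r n * _]mulrC eP rmorph_sum mulr_sumr.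
  by apply: eq_bigr => i _; rewrite rmorphM; ring.
exists (m + p)%N.
exists (fun i k => if (i < n)%N then if (k < m)%N then d i k else - e (k - m)%N i
                   else if (k < m)%N then 0 else c (k - m)%N).
exists (fun k => if (k < m)%N then t k else u (k - m)%N); split=> [i|k kmp].
  rewrite big_split_ord /= ltnS leq_eqVlt => /predU1P[->|ni].
    rewrite ltnn big1 ?add0r => [|k _]; last by rewrite ltn_ord rmorph0 mul0r.
    rewrite sn; apply: eq_bigr => j _ /=.
    by rewrite ltnNge leq_addr /= addKn mulrC.
  rewrite ni -[LHS](addrK (\sum_(j < p) f (e j i) * u j)) (s'E i ni) -sumrN.
  congr (_ + _); apply: eq_bigr => k _; first by rewrite ltn_ord.
  by rewrite ltnNge leq_addr /= addKn rmorphN mulNr.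
rewrite big_ord_recr /= ltnn; have [km|mk] := ltnP k m.
  rewrite mulr0 addr0 -[RHS](rd0 k km).
  by apply: eq_bigr => i _; rewrite ltn_ord.
apply/eqP; rewrite addr_eq0 [r n * _]mulrC eP -sumrN; apply/eqP.
by apply: eq_bigr => i _; rewrite ltn_ord mulrN mulrC.
Qed.

(** What flatness lacks to be faithful: no expression of [1] has all its
    coefficients in [M]. *)
Lemma one_in_span m (d : nat -> R) (t : nat -> S) :
  1 = \sum_(k < m) f (d k) * t k -> exists2 k, (k < m)%N & ~ ideal_set M (d k).
Proof.
move=> e; apply: contrapT => no; apply: (local_not1 ext_local); rewrite e.
have hN := is_ideal_ext f M.
apply: (id_sum (F := fun k => f (d k) * t k) hN) => k km.
apply: (idMr _ hN); apply: mem_ext; apply: contrapT => Mdk; apply: no.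
by exists k.
Qed.

End CompletionOfLocal.

(** * The inverse limit is an adic completion *)

Section QuotMap.
Variables (R : comPzRingType) (I : ideal R).

(** A name for the projection under which its ring morphism structure can be
    inferred. *)
Definition quot_map (r : R) : ring_quot I := \pi_(ring_quot I) r.

Arguments quot_map r : simpl never.

HB.instance Definition _ := GRing.isZmodMorphism.Build R (ring_quot I) quot_map
  (@pi_ring_quot_is_zmod_morphism R I).
HB.instance Definition _ := GRing.isMonoidMorphism.Build R (ring_quot I) quot_map
  (@pi_ring_quot_is_monoid_morphism R I).

Lemma quot_mapP (x y : R) : quot_map x = quot_map y <-> ideal_set I (x - y).
Proof. exact: ring_quot_eqP. Qed.

Lemma quot_map0P (x : R) : quot_map x = 0 <-> ideal_set I x.
Proof. by rewrite -(rmorph0 quot_map) quot_mapP subr0. Qed.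

Lemma quot_mapK (x : ring_quot I) : quot_map (repr x) = x.
Proof. exact: reprK. Qed.

End QuotMap.

Section InverseLimit.
Variables (R : comPzRingType) (J : ideal R).

Notation Q k := (ring_quot (ideal_pow J k)).
Notation C := (completion J).
Notation piQ k := (quot_map (ideal_pow J k)).

Definition compl_coord (k : nat) (x : C) : Q k := completion_val x k.

Lemma compl_coordB k : zmod_morphism (compl_coord k).
Proof. by []. Qed.

Lemma compl_coordM k : monoid_morphism (compl_coord k).
Proof. by []. Qed.

Arguments compl_coord k x : simpl never.

HB.instance Definition _ k :=
  GRing.isZmodMorphism.Build C (Q k) (compl_coord k) (compl_coordB k).
HB.instance Definition _ k :=
  GRing.isMonoidMorphism.Build C (Q k) (compl_coord k) (compl_coordM k).

Lemma compl_ext (x y : C) : (forall k, compl_coord k x = compl_coord k y) -> x = y.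
Proof. by move=> xy; apply: val_inj; exact: functional_extensionality_dep. Qed.

Lemma compl_coordP (x : C) k : quot_trans (ideal_pow J k) (compl_coord k.+1 x) = compl_coord k x.
Proof. by rewrite /compl_coord; case: x => x /= /asboolP. Qed.

Lemma compl_ofP (x : dep_prod (fun k => Q k)) :
  (forall k, quot_trans (ideal_pow J k) (x k.+1) = x k) -> x \in @compatible _ J.
Proof. by move=> xP; apply/asboolP. Qed.

Definition to_compl (r : R) : C :=
  Completion (compl_ofP (x := fun k => piQ k r)
    (fun k => quot_trans_pi (@ideal_powS_sub _ J k) r)).

Lemma to_complB : zmod_morphism to_compl.
Proof.
move=> x y; apply: compl_ext => k.
exact: (@pi_ring_quot_is_zmod_morphism _ (ideal_pow J k)).
Qed.

Lemma to_complM : monoid_morphism to_compl.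
Proof.
split; first by apply: compl_ext => k.
move=> x y; apply: compl_ext => k.
exact: (@pi_ring_quot_is_monoid_morphism _ (ideal_pow J k)).2.
Qed.

Arguments to_compl r : simpl never.

HB.instance Definition _ := GRing.isZmodMorphism.Build R C to_compl to_complB.
HB.instance Definition _ := GRing.isMonoidMorphism.Build R C to_compl to_complM.

Lemma to_compl_coord k r : compl_coord k (to_compl r) = piQ k r.
Proof. by []. Qed.

Lemma compl_coord_trans (x : C) k r :
  compl_coord k.+1 x = piQ k.+1 r -> compl_coord k x = piQ k r.
Proof.
by move=> xr; rewrite -compl_coordP xr quot_trans_pi //; exact: ideal_powS_sub.
Qed.

Lemma compl_coord_rep (x : C) : exists r : nat -> R,
  forall n m, (n <= m)%N -> compl_coord n x = piQ n (r m).
Proof.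
exists (fun m => repr (compl_coord m x)) => n m nm.
rewrite -(subnKC nm); move: (m - n)%N => d; elim: d n {nm} => [|d IH] n.
  by rewrite addn0 quot_mapK.
by apply: compl_coord_trans; rewrite addnS -addSn.
Qed.

Lemma compl_limit (r : nat -> R) : (forall k, powI J k (r k.+1 - r k)) ->
  exists x : C, forall k, compl_coord k x = piQ k (r k).
Proof.
move=> rJ; have cr k : quot_trans (ideal_pow J k) (piQ k.+1 (r k.+1)) = piQ k (r k).
  rewrite quot_trans_pi; last exact: ideal_powS_sub.
  by apply/quot_mapP; exact: rJ.
by exists (Completion (compl_ofP cr)).
Qed.

Lemma ext_coord0 k x : powI (ext to_compl J) k x -> compl_coord k x = 0.
Proof.
rewrite ext_pow; move: x; apply: (ext_sub (K := fun x => compl_coord k x = 0)).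
  split=> [|x y x0 y0|a x x0]; first exact: rmorph0.
    by rewrite rmorphD /= x0 y0 addr0.
  by rewrite rmorphM /= x0 mulr0.
by move=> r Jr; rewrite to_compl_coord; apply/quot_map0P.
Qed.

(** Finite generation of [J ^ k] enters here: an element whose [k]-th coordinate
    vanishes is a convergent series of elements of [J ^ n * J ^ k]. *)
Lemma coord0_ext k x : noetherian R -> compl_coord k x = 0 ->
  powI (ext to_compl J) k x.
Proof.
move=> nR xk0; rewrite ext_pow; have [r rP] := compl_coord_rep x.
have [g gE] := noeth_fg nR (is_ideal_pow J k).
have [e0 e0P] : exists e : nat -> R, r k = \sum_(i < size g) e i * g`_i.
  have : powI J k (r k) by apply/quot_map0P; rewrite -rP.
  by rewrite gE.
have /choice[e eP] : forall n, exists c : nat -> R, (forall i, powI J n (c i)) /\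
    r (n.+1 + k)%N - r (n + k)%N = \sum_(i < size g) c i * g`_i.
  move=> n; apply: mul_spanP; first exact: is_ideal_pow.
  rewrite -gE; apply: pow_split; apply/quot_mapP.
  by rewrite -!rP ?addSn.
have /choice[y yP] : forall i, exists y : C, forall n,
    compl_coord n y = piQ n (e0 i + \sum_(j < n) e j i).
  move=> i; apply: compl_limit => n.
  rewrite big_ord_recr /=.
  have -> : forall a b c : R, a + (b + c) - (a + b) = c by move=> a b c; ring.
  by case: (eP n).
have -> : x = \sum_(i < size g) y i * to_compl g`_i.
  apply: compl_ext => n; rewrite (rP n (n + k)%N) ?leq_addr // rmorph_sum /=.
  have cE i : compl_coord n (y i * to_compl g`_i) =
      piQ n ((e0 i + \sum_(j < n) e j i) * g`_i).
    by rewrite rmorphM /= yP [RHS]rmorphM.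
  under [RHS]eq_bigr do rewrite cE.
  rewrite -rmorph_sum; congr (piQ n _).
  elim: (n) => [|m IH].
    by rewrite e0P; apply: eq_bigr => i _; rewrite big_ord0 addr0.
  rewrite -[LHS](subrK (r (m + k)%N)) (eP m).2 IH -big_split.
  by apply: eq_bigr => i _; rewrite big_ord_recr /=; ring.
have hK := is_ideal_ext to_compl (powI J k).
apply: (id_sum (F := fun i => y i * to_compl g`_i) hK) => i ig.
apply: (idMl _ hK); apply: mem_ext; rewrite gE; apply: mem_span; exact: mem_nth.
Qed.

Lemma to_compl_is_completion : noetherian R -> is_completion to_compl J.
Proof.
move=> nR; split=> [s k|r k|s s0|u uE].
- have [r rP] := compl_coord_rep s; exists (r k); apply: coord0_ext => //.
  by rewrite rmorphB /= (rP k k) // subrr.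
- by move/ext_coord0 => rk; apply/quot_map0P.
- by apply: compl_ext => k; rewrite (ext_coord0 (s0 k)) rmorph0.
have cu k : quot_trans (ideal_pow J k) (compl_coord k.+1 (u k.+1)) = compl_coord k (u k).
  rewrite compl_coordP; apply/eqP; rewrite -subr_eq0 -rmorphB; apply/eqP.
  exact: ext_coord0.
exists (Completion (compl_ofP cu)) => k; apply: coord0_ext => //.
rewrite rmorphB; exact: subrr.
Qed.

End InverseLimit.

(** * Isomorphisms *)

Lemma inj_surj_bij (A B : Type) (f : A -> B) :
  injective f -> (forall y, exists x, f x = y) -> bijective f.
Proof.
move=> fI /choice[g gP]; exists g => // x; exact: fI.
Qed.

Lemma rmorph_inverse (A B : pzRingType) (f : {rmorphism A -> B}) : bijective f ->
  exists g : {rmorphism B -> A}, cancel f g /\ cancel g f.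
Proof.
case=> g fK gK.
have gB : zmod_morphism g by exact: can2_zmod_morphism fK gK.
have gM : monoid_morphism g by exact: can2_monoid_morphism fK gK.
pose mB := GRing.isZmodMorphism.Build B A g gB.
pose mM := GRing.isMonoidMorphism.Build B A g gM.
by exists (HB.pack_for {rmorphism B -> A} g mB mM).
Qed.

Lemma ring_isom_sym (A B : pzRingType) : ring_isom A B -> ring_isom B A.
Proof.
by case=> f /rmorph_inverse[g [fK gK]]; exists g; exists f.
Qed.

Lemma spec_inj (A : comPzRingType) (P Q : spec A) : val P = val Q -> P = Q.
Proof. exact: (@val_inj _ _ (set_type (Spec A))). Qed.

Lemma homeomorphic_spec (A B : comPzRingType) :
  ring_isom A B -> homeomorphic (spec A) (spec B).
Proof.
case=> f /rmorph_inverse[g [fK gK]].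
have pre (U V : comPzRingType) (h : {rmorphism U -> V}) (P : spec V) :
    h @^-1` val P \in Spec U.
  by apply/mem_set; exact: prime_preim (spec_prime P).
pose F (U V : comPzRingType) (h : {rmorphism U -> V}) (P : spec V) : spec U :=
  exist (fun Q => Q \in Spec U) _ (pre U V h P).
have Fc (U V : comPzRingType) (h : {rmorphism U -> V}) : continuous (F U V h).
  apply/continuousP => _ [E ->]; exists (h @` E).
  apply/seteqP; split=> P /= nE sE; apply: nE.
    by move=> x Ex; apply: sE; exists x.
  by move=> _ [x Ex <-]; exact: sE.
exists (F B A g), (F A B f); split; [exact: Fc|exact: Fc| |] => P;
  apply: spec_inj; rewrite /= predeqE => x.
  by rewrite /preimage /= fK.
by rewrite /preimage /= gK.
Qed.

Section InducedIsomorphisms.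
Variables (R S : comPzRingType) (f : {rmorphism R -> S}).

Section Quotient.
Variables (I : ideal R) (K : ideal S).
Hypothesis dense : forall s, exists r, ideal_set K (s - f r).
Hypothesis contract : forall r, ideal_set K (f r) <-> ideal_set I r.

Definition quot_ind (x : ring_quot I) : ring_quot K := quot_map K (f (repr x)).

Arguments quot_ind x : simpl never.

Lemma quot_indE r : quot_ind (quot_map I r) = quot_map K (f r).
Proof.
apply/quot_mapP; rewrite -rmorphB contract; apply/quot_mapP.
exact: quot_mapK.
Qed.

Lemma quot_indB : zmod_morphism quot_ind.
Proof.
move=> x y; rewrite -[x]quot_mapK -[y]quot_mapK -rmorphB !quot_indE.
by rewrite !rmorphB.
Qed.

Lemma quot_indM : monoid_morphism quot_ind.
Proof.
split=> [|x y]; first by rewrite -(rmorph1 (quot_map I)) quot_indE !rmorph1.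
rewrite -[x]quot_mapK -[y]quot_mapK -rmorphM !quot_indE.
by rewrite !rmorphM.
Qed.

HB.instance Definition _ :=
  GRing.isZmodMorphism.Build (ring_quot I) (ring_quot K) quot_ind quot_indB.
HB.instance Definition _ :=
  GRing.isMonoidMorphism.Build (ring_quot I) (ring_quot K) quot_ind quot_indM.

Lemma quot_ind_inj : injective quot_ind.
Proof.
apply: raddf_inj => x /=; rewrite -[x]quot_mapK quot_indE => /quot_map0P.
by move/contract => ?; apply/quot_map0P.
Qed.

Lemma quot_ind_surj y : exists x, quot_ind x = y.
Proof.
have [r Kr] := dense (repr y); exists (quot_map I r); rewrite quot_indE.
rewrite -[RHS]quot_mapK; apply/quot_mapP.
by rewrite -opprB; exact: idN (ideal_setP K) Kr.
Qed.

Lemma quot_isom : ring_isom (ring_quot K) (ring_quot I).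
Proof.
apply: ring_isom_sym; exists quot_ind; apply: inj_surj_bij quot_ind_surj.
exact: quot_ind_inj.
Qed.

End Quotient.

Section Completion.
Variables (M : ideal R) (N : ideal S).
Hypothesis dense : forall s k, exists r, powI N k (s - f r).
Hypothesis contract : forall r k, powI N k (f r) <-> powI M k r.

Lemma compl_ind_compat (x : completion M) k :
  quot_trans (ideal_pow N k) (quot_ind (ideal_pow N k.+1) (compl_coord k.+1 x)) =
  quot_ind (ideal_pow N k) (compl_coord k x).
Proof.
have [r rP] := compl_coord_rep x.
rewrite (rP k.+1 k.+1) // (rP k k.+1) // !quot_indE; try by move=> r'; exact: contract.
by rewrite quot_trans_pi //; exact: ideal_powS_sub.
Qed.

Definition compl_ind (x : completion M) : completion N :=
  Completion (compl_ofP (compl_ind_compat x)).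

Arguments compl_ind x : simpl never.

Lemma compl_ind_coord k x :
  compl_coord k (compl_ind x) = quot_ind (ideal_pow N k) (compl_coord k x).
Proof. by []. Qed.

Lemma compl_indB : zmod_morphism compl_ind.
Proof.
move=> x y; apply: compl_ext => k; rewrite compl_ind_coord rmorphB [RHS]rmorphB /=.
by [].
Qed.

Lemma compl_indM : monoid_morphism compl_ind.
Proof.
split=> [|x y]; apply: compl_ext => k; rewrite compl_ind_coord.
  by rewrite [compl_coord k 1]rmorph1 rmorph1.
by rewrite rmorphM [RHS]rmorphM.
Qed.

HB.instance Definition _ :=
  GRing.isZmodMorphism.Build (completion M) (completion N) compl_ind compl_indB.
HB.instance Definition _ :=
  GRing.isMonoidMorphism.Build (completion M) (completion N) compl_ind compl_indM.

Lemma completion_isom : ring_isom (completion N) (completion M).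
Proof.
apply: ring_isom_sym; exists compl_ind; apply: inj_surj_bij => [|y].
  move=> x y xy; apply: compl_ext => k.
  apply: (quot_ind_inj (K := ideal_pow N k)) => [r|]; first exact: contract.
  by rewrite -!compl_ind_coord xy.
have [s sP] := compl_coord_rep y.
have /choice[r rP] := fun k => dense (s k) k.
have [k|x xP] := @compl_limit _ M r.
  apply/contract; rewrite rmorphB.
  have -> : f (r k.+1) - f (r k) =
     (s k - f (r k)) - (s k.+1 - f (r k.+1)) + (s k.+1 - s k) by ring.
  have hN := is_ideal_pow N k.
  apply: (idD hN).
    apply: (idB hN) => //; apply: (ideal_powS_sub (k := k)); exact: rP.
  by apply/quot_mapP; rewrite -!sP.
exists x; apply: compl_ext => k; rewrite compl_ind_coord xP quot_indE.
  rewrite (sP k k) //; apply/quot_mapP; rewrite -opprB.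
  exact: idN (is_ideal_pow N k) (rP k).
by move=> r'; exact: contract.
Qed.

End Completion.

End InducedIsomorphisms.

(** * Tensor products with a flat module *)

Section FlatModule.
Variables (R : comNzRingType) (S : lmodType R).

Definition mod_flat := forall n (r : nat -> R) (s : nat -> S),
  \sum_(i < n) r i *: s i = 0 ->
  exists m (d : nat -> nat -> R) (t : nat -> S),
    (forall i, (i < n)%N -> s i = \sum_(k < m) d i k *: t k) /\
    (forall k, (k < m)%N -> \sum_(i < n) r i * d i k = 0).

Hypothesis flatS : mod_flat.

Lemma sum_delta (V : lmodType R) n (F : nat -> V) i : (i < n)%N ->
  \sum_(k < n) (k == i :> nat)%:R *: F k = F i.
Proof.
move=> ni; rewrite (bigD1 (Ordinal ni)) //= eqxx scale1r big1 ?addr0 // => k.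
by rewrite -val_eqE /= => /negbTE ->; rewrite scale0r.
Qed.

Lemma mod_flat_system p n (c : nat -> nat -> R) (s : nat -> S) :
  (forall j, (j < p)%N -> \sum_(i < n) c j i *: s i = 0) ->
  exists m (d : nat -> nat -> R) (t : nat -> S),
    (forall i, (i < n)%N -> s i = \sum_(k < m) d i k *: t k) /\
    (forall j k, (j < p)%N -> (k < m)%N -> \sum_(i < n) c j i * d i k = 0).
Proof.
elim: p => [|p IH] cs.
  by exists n, (fun i k => (k == i)%:R), s; split=> // i ni; rewrite sum_delta.
have [|m [d [t [sE cd]]]] := IH; first by move=> j jp; apply: cs; exact: ltnW.
have [|m' [e [u [tE ce]]]] := @flatS m (fun k => \sum_(i < n) c p i * d i k) t.
  under eq_bigr do rewrite scaler_suml.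
  rewrite exchange_big -[RHS](cs p) //; apply: eq_bigr => i _ /=.
  by rewrite sE // scaler_sumr; apply: eq_bigr => k _; rewrite scalerA.
have cdeE j l : \sum_(i < n) c j i * (\sum_(k < m) d i k * e k l) =
    \sum_(k < m) (\sum_(i < n) c j i * d i k) * e k l.
  under eq_bigr do rewrite mulr_sumr.
  rewrite exchange_big; apply: eq_bigr => k _ /=.
  by rewrite mulr_suml; apply: eq_bigr => i _; rewrite mulrA.
exists m', (fun i l => \sum_(k < m) d i k * e k l), u; split=> [i ni|j l].
  under eq_bigr do rewrite scaler_suml.
  rewrite exchange_big sE //; apply: eq_bigr => k _ /=.
  by rewrite tE // scaler_sumr; apply: eq_bigr => l _; rewrite scalerA.
rewrite ltnS cdeE leq_eqVlt => /predU1P[->|jp] lm'; first exact: ce.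
by rewrite big1 // => k _; rewrite cd // mul0r.
Qed.

Section Lists.
Variable B : lmodType R.
Implicit Types (p : seq (B * S)) (q : seq (B * (nat -> R))).

(** A list of pairs [(b, c)] is an element of [B (x) R ^ m], the [k]-th
    coordinate of which is [coord q k]. A family [t] of [m] elements of [S] maps
    it to a formal sum of tensors in [B (x) S]. *)
Definition push m (t : nat -> S) (x : B * (nat -> R)) : B * S :=
  (x.1, \sum_(k < m) x.2 k *: t k).

Definition coord q k : B := \sum_(x <- q) x.2 k *: x.1.

Definition base_change m (d : nat -> nat -> R) (x : B * (nat -> R)) :
  B * (nat -> R) := (x.1, fun l => \sum_(k < m) x.2 k * d k l).

Lemma push_base_change m (t : nat -> S) m' (u : nat -> S) (d : nat -> nat -> R) :
  (forall k, (k < m)%N -> t k = \sum_(l < m') d k l *: u l) ->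
  forall x, push m' u (base_change m d x) = push m t x.
Proof.
move=> tE [b c]; rewrite /push /=; congr (_, _).
under eq_bigr do rewrite scaler_suml.
rewrite exchange_big; apply: eq_bigr => k _ /=.
by rewrite tE // scaler_sumr; apply: eq_bigr => l _; rewrite scalerA.
Qed.

Lemma coord_base_change m d q l :
  coord (map (base_change m d) q) l = \sum_(k < m) d k l *: coord q k.
Proof.
rewrite /coord big_map; under eq_bigr do rewrite scaler_suml.
rewrite exchange_big; apply: eq_bigr => k _ /=.
by rewrite scaler_sumr; apply: eq_bigr => x _; rewrite scalerA mulrC.
Qed.

Lemma coord_cat q q' k : coord (q ++ q') k = coord q k + coord q' k.
Proof. by rewrite /coord big_cat. Qed.

Lemma eq_coord_base_change m d q q' l :
  (forall k, (k < m)%N -> coord q k = coord q' k) ->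
  coord (map (base_change m d) q) l = coord (map (base_change m d) q') l.
Proof. by move=> qq'; rewrite !coord_base_change; apply: eq_bigr => k _; rewrite qq'. Qed.

(** Equality of tensors at some finite free level. As a flat module is a filtered
    colimit of finite free ones, this is equality in [B (x) S]. *)
Definition same_tensor p p' := exists m t q q',
  [/\ p = map (push m t) q, p' = map (push m t) q' &
      forall k, (k < m)%N -> coord q k = coord q' k].

Lemma exists_lift p : exists m t q, p = map (push m t) q.
Proof.
exists (size p), (fun k => (nth 0 p k).2).
exists (mkseq (fun i => ((nth 0 p i).1, fun k => (k == i)%:R)) (size p)).
apply: (@eq_from_nth _ 0) => [|i ip]; first by rewrite size_map size_mkseq.
rewrite (nth_map 0) ?size_mkseq // nth_mkseq // /push /=.
rewrite (sum_delta (fun k => (nth 0 p k).2)) //.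
by case: nth.
Qed.

Lemma common_level m (t : nat -> S) m1 (t1 : nat -> S) :
  exists n (u : nat -> S) (d d1 : nat -> nat -> R),
  (forall k, (k < m)%N -> t k = \sum_(l < n) d k l *: u l) /\
  (forall k, (k < m1)%N -> t1 k = \sum_(l < n) d1 k l *: u l).
Proof.
exists (m + m1)%N, (fun l => if (l < m)%N then t l else t1 (l - m)%N).
exists (fun k l => (l == k)%:R), (fun k l => (l == m + k)%N%:R); split=> k km.
  rewrite (sum_delta (fun l => if (l < m)%N then t l else t1 (l - m)%N)) ?km //.
  by apply: leq_trans km _; exact: leq_addr.
rewrite (sum_delta (fun l => if (l < m)%N then t l else t1 (l - m)%N)) ?ltn_add2l //.
by rewrite ltnNge leq_addr /= addKn.
Qed.

Lemma map_push_base_change m (t : nat -> S) n (u : nat -> S) (d : nat -> nat -> R) q :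
  (forall k, (k < m)%N -> t k = \sum_(l < n) d k l *: u l) ->
  map (push m t) q = map (push n u) (map (base_change m d) q).
Proof.
by move=> tE; rewrite -map_comp; apply: eq_map => x /=; rewrite (push_base_change tE).
Qed.

Lemma exists_lift2 p p' : exists m t q q',
  p = map (push m t) q /\ p' = map (push m t) q'.
Proof.
have [[m [t [q ->]]] [m1 [t1 [q1 ->]]]] := (exists_lift p, exists_lift p').
have [n [u [d [d1 [tE t1E]]]]] := common_level m t m1 t1.
exists n, u, (map (base_change m d) q), (map (base_change m1 d1) q1).
by split; exact: map_push_base_change.
Qed.

Lemma same_tensor_refl p : same_tensor p p.
Proof. by have [m [t [q ->]]] := exists_lift p; exists m, t, q, q. Qed.

Lemma same_tensor_sym p p' : same_tensor p p' -> same_tensor p' p.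
Proof.
by move=> [m [t [q [q' [-> -> qq']]]]]; exists m, t, q', q; split=> // k /qq'.
Qed.

Lemma same_tensor_cat p p' r r' : same_tensor p p' -> same_tensor r r' ->
  same_tensor (p ++ r) (p' ++ r').
Proof.
move=> [m [t [q [q' [-> -> qq']]]]] [m1 [t1 [q1 [q1' [-> -> qq1]]]]].
have [n [u [d [d1 [tE t1E]]]]] := common_level m t m1 t1.
exists n, u, (map (base_change m d) q ++ map (base_change m1 d1) q1),
  (map (base_change m d) q' ++ map (base_change m1 d1) q1').
rewrite !map_cat -!(map_push_base_change _ tE) -!(map_push_base_change _ t1E).
split=> // k _; rewrite !coord_cat.
by congr (_ + _); exact: eq_coord_base_change.
Qed.

(** Flatness enters here: two lifts of the middle list differ by relations in
    [S], which a further base change trivializes. *)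
Lemma same_tensor_trans p p' p'' :
  same_tensor p p' -> same_tensor p' p'' -> same_tensor p p''.
Proof.
move=> [m [t [q [q' [-> pE qq']]]]] [m1 [t1 [q1' [q1 [pE1 -> qq1]]]]].
pose x0 : B * (nat -> R) := (0, fun=> 0).
have szq : size q' = size q1' by move: pE; rewrite pE1 => /(congr1 size); rewrite !size_map.
have pj j : (j < size q')%N -> push m t (nth x0 q' j) = push m1 t1 (nth x0 q1' j).
  move=> jq; rewrite -(nth_map x0 (push m t x0)) // -pE pE1 (nth_map x0) //.
  by rewrite -szq.
pose T := fun i => if (i < m)%N then t i else t1 (i - m)%N.
pose c j i := if (i < m)%N then (nth x0 q' j).2 i else - (nth x0 q1' j).2 (i - m)%N.
have Tm1 (i : nat) : ((m + i < m)%N = false) * ((m + i - m)%N = i).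
  by rewrite ltnNge leq_addr addKn.
have [|n [d [u [TE cd]]]] := @mod_flat_system (size q') (m + m1)%N c T.
  move=> j /pj[_ e]; rewrite big_split_ord /= /c /T.
  under eq_bigr do rewrite ltn_ord.
  rewrite e; under [X in _ + X]eq_bigr do rewrite !Tm1 scaleNr.
  by rewrite sumrN subrr.
have tE k : (k < m)%N -> t k = \sum_(l < n) d k l *: u l.
  by move=> km; rewrite -TE /T ?km // ltn_addr.
have t1E k : (k < m1)%N -> t1 k = \sum_(l < n) d (m + k)%N l *: u l.
  by move=> km; rewrite -TE /T ?ltn_add2l // !Tm1.
pose d1 k l := d (m + k)%N l.
exists n, u, (map (base_change m d) q), (map (base_change m1 d1) q1).
split; [exact: map_push_base_change|exact: map_push_base_change|move=> l ln].
rewrite (eq_coord_base_change _ _ qq') -(eq_coord_base_change _ _ qq1).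
rewrite /coord !big_map !(big_nth x0) -szq !big_mkord; apply: eq_bigr => j _ /=.
have [-> _] := pj j (ltn_ord j); congr (_ *: _).
apply/eqP; rewrite -subr_eq0 -[X in _ == X](cd j l) // big_split_ord /= /c.
apply/eqP; congr (_ + _); first by apply: eq_bigr => i _; rewrite ltn_ord.
by rewrite -sumrN; apply: eq_bigr => i _; rewrite !Tm1 mulNr.
Qed.

Definition same_tensorb p p' : bool := `[< same_tensor p p' >].

Lemma same_tensorb_is_equiv : equiv_class_of same_tensorb.
Proof.
split=> [p|p p'|p p' p''].
- exact/asboolP/same_tensor_refl.
- by apply/asboolP/asboolP; exact: same_tensor_sym.
- move=> /asboolP pp' /asboolP p'p''; apply/asboolP.
  exact: same_tensor_trans p'p''.
Qed.

Canonical same_tensorb_equiv := EquivRelPack same_tensorb_is_equiv.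

(** A model of [B (x) S] in which equality is explicit, whereas equality in
    [tensor] is tested against all bilinear maps. *)
Definition flat_tensor : Type := {eq_quot same_tensorb}.

HB.instance Definition _ := Choice.on flat_tensor.
HB.instance Definition _ := Quotient.on flat_tensor.

Definition ft_class p : flat_tensor := \pi_flat_tensor p.

Lemma ft_classP p p' : ft_class p = ft_class p' <-> same_tensor p p'.
Proof. by split=> [/eqmodP/asboolP|pp'] //; apply/eqmodP/asboolP. Qed.

Lemma ft_classK (x : flat_tensor) : ft_class (repr x) = x.
Proof. exact: reprK. Qed.

Lemma ft_repr p : same_tensor (repr (ft_class p)) p.
Proof. by apply/ft_classP; exact: ft_classK. Qed.

Definition pair_scale (r : R) (x : B * S) := (r *: x.1, x.2).

Lemma coord_scale r q k :
  coord [seq (r *: x.1, x.2) | x <- q] k = r *: coord q k.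
Proof.
rewrite /coord big_map scaler_sumr; apply: eq_bigr => x _ /=.
by rewrite !scalerA mulrC.
Qed.

Lemma push_scale r m t q : map (pair_scale r) (map (push m t) q) =
  map (push m t) [seq (r *: x.1, x.2) | x <- q].
Proof. by rewrite -!map_comp. Qed.

Lemma same_tensor_scale r p p' : same_tensor p p' ->
  same_tensor (map (pair_scale r) p) (map (pair_scale r) p').
Proof.
move=> [m [t [q [q' [-> -> qq']]]]]; rewrite !push_scale.
exists m, t, [seq (r *: x.1, x.2) | x <- q], [seq (r *: x.1, x.2) | x <- q'].
by split=> // k km; rewrite !coord_scale qq'.
Qed.

Let add (x y : flat_tensor) := ft_class (repr x ++ repr y).
Let scale r (x : flat_tensor) := ft_class (map (pair_scale r) (repr x)).

Let addE p p' : add (ft_class p) (ft_class p') = ft_class (p ++ p').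
Proof. by apply/ft_classP; apply: same_tensor_cat; exact: ft_repr. Qed.

Let scaleE r p : scale r (ft_class p) = ft_class (map (pair_scale r) p).
Proof. by apply/ft_classP; apply: same_tensor_scale; exact: ft_repr. Qed.

Let addA : associative add.
Proof.
by move=> x y z; rewrite -[x]ft_classK -[y]ft_classK -[z]ft_classK !addE catA.
Qed.

Let addC : commutative add.
Proof.
move=> x y; rewrite -[x]ft_classK -[y]ft_classK !addE; apply/ft_classP.
have [m [t [q [q' [-> ->]]]]] := exists_lift2 (repr x) (repr y).
exists m, t, (q ++ q'), (q' ++ q); rewrite !map_cat; split=> // k _.
by rewrite !coord_cat addrC.
Qed.

Let add0 : left_id (ft_class [::]) add.
Proof. by move=> x; rewrite -[x]ft_classK addE. Qed.

Let addN : left_inverse (ft_class [::]) (scale (-1)) add.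
Proof.
move=> x; rewrite -[x]ft_classK scaleE addE; apply/ft_classP.
have [m [t [q ->]]] := exists_lift (repr x).
exists m, t, ([seq (-1 *: x.1, x.2) | x <- q] ++ q), [::]; split=> //.
  by rewrite push_scale map_cat.
by move=> k _; rewrite coord_cat coord_scale scaleN1r addNr /coord big_nil.
Qed.

HB.instance Definition _ :=
  GRing.isZmodule.Build flat_tensor addA addC add0 addN.

Let scaleA r s x : scale r (scale s x) = scale (r * s) x.
Proof.
rewrite -[x]ft_classK !scaleE -map_comp; congr ft_class.
by apply: eq_map => -[b c]; rewrite /pair_scale /= scalerA.
Qed.

Let scale1 : left_id 1 scale.
Proof.
move=> x; rewrite -[x]ft_classK !scaleE; congr ft_class.
by rewrite -[RHS]map_id; apply: eq_map => -[b c]; rewrite /pair_scale /= scale1r.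
Qed.

Let scaleDr : right_distributive scale +%R.
Proof.
move=> r x y; rewrite -[_ + y]/(add x y) -[RHS]/(add _ _).
by rewrite -[x]ft_classK -[y]ft_classK !(scaleE, addE) map_cat.
Qed.

Let scaleDl x : {morph scale^~ x : r s / r + s}.
Proof.
move=> r s; rewrite -[RHS]/(add _ _) -[x]ft_classK !scaleE addE; apply/ft_classP.
have [m [t [q ->]]] := exists_lift (repr x).
exists m, t, [seq ((r + s) *: x.1, x.2) | x <- q],
  ([seq (r *: x.1, x.2) | x <- q] ++ [seq (s *: x.1, x.2) | x <- q]).
rewrite !push_scale map_cat; split=> // k _.
by rewrite coord_cat !coord_scale scalerDl.
Qed.

HB.instance Definition _ :=
  GRing.Zmodule_isLmodule.Build R flat_tensor scaleA scale1 scaleDr scaleDl.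

Definition ft_tens (b : B) (s : S) : flat_tensor := ft_class [:: (b, s)].

Lemma ft_tens_is_bilinear :
  bilinear_for (GRing.Scale.Law.clone _ _ *:%R _)
    (GRing.Scale.Law.clone _ _ *:%R _) ft_tens.
Proof.
split=> [s r b b'|b r s s']; rewrite -[RHS]/(add (scale _ _) _) scaleE addE;
  apply/ft_classP.
  exists 1%N, (fun=> s), [:: (r *: b + b', fun=> 1)],
    [:: (r *: b, fun=> 1); (b', fun=> 1)].
  rewrite /= /push /= !big_ord1 !scale1r; split=> // k _.
  by rewrite /coord !big_cons !big_nil !scale1r !addr0.
pose t k := if k is 0%N then s else s'.
exists 2%N, t, [:: (b, fun k => if k is 0%N then r else 1)],
  [:: (r *: b, fun k => (k == 0%N)%:R); (b, fun k => (k == 1%N)%:R)].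
rewrite /= /push /= !big_ord_recl !big_ord0 /= !scale1r !scale0r !addr0 add0r.
split=> // k; rewrite /coord !big_cons !big_nil /=.
by case: k => [|[|]] //= _; rewrite ?(scale1r, scale0r, addr0, add0r).
Qed.

HB.instance Definition _ :=
  bilinear_isBilinear.Build R B S flat_tensor _ _ ft_tens ft_tens_is_bilinear.

Lemma ft_classE p : ft_class p = \sum_(x <- p) ft_tens x.1 x.2.
Proof.
elim: p => [|[b s] p IH]; first by rewrite big_nil.
by rewrite big_cons -IH -[RHS]/(add _ _) addE.
Qed.

(** The vanishing criterion for tensors with a flat module, read off from the
    bilinear map [ft_tens]. *)
Lemma tensor_eq0 p : \sum_(x <- p) tens x.1 x.2 = 0 :> tensor B S ->
  exists m t q, p = map (push m t) q /\ forall k, (k < m)%N -> coord q k = 0.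
Proof.
move=> /(congr1 (tensor_lift ft_tens)); rewrite raddf0 raddf_sum /=.
under eq_bigr do rewrite tensor_lift_tens.
rewrite -ft_classE => /ft_classP[m [t [q [[|? ?] [-> // _ q0]]]]].
by exists m, t, q; split=> // k /q0 ->; rewrite /coord big_nil.
Qed.

End Lists.

Lemma tensor_sum (A : lmodType R) (x : tensor A S) :
  exists p, x = \sum_(y <- p) tens y.1 y.2.
Proof. by exists (repr x); rewrite -[LHS]reprK tensorE. Qed.

Lemma sum_push (B : lmodType R) m t (q : seq (B * (nat -> R))) :
  \sum_(x <- map (push m t) q) tens x.1 x.2 =
  \sum_(k < m) tens (coord q k) (t k) :> tensor B S.
Proof.
rewrite big_map; under eq_bigr do rewrite /push /= linear_sumr.
rewrite exchange_big; apply: eq_bigr => k _ /=.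
rewrite /coord.
elim: q => [|x q IH]; first by rewrite !big_nil linear0l.
by rewrite !big_cons linearDl IH linearZl linearZr.
Qed.

Lemma lift_preim (B C : lmodType R) (g : {linear B -> C}) m t p
    (q : seq (C * (nat -> R))) :
  [seq (g x.1, x.2) | x <- p] = map (push m t) q ->
  exists q', p = map (push m t) q' /\ forall k, g (coord q' k) = coord q k.
Proof.
elim: p q => [|[b s] p IH] [|[c y] q] //=.
  by exists [::]; split=> // k; rewrite /coord !big_nil raddf0.
case=> gb sE /IH[q' [-> gq']]; exists ((b, y) :: q'); split=> [|k].
  by rewrite /= /push /= -sE.
by rewrite /coord !big_cons raddfD /= linearZ /= gb; congr (_ + _); exact: gq'.
Qed.

(** A tensor killed by [g] lifts to some [B (x) R ^ m] as a vector killed by [g],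
    where exactness applies to each coordinate. Conversely, if [b (x) one]
    vanishes, so does [d * b] for all the coefficients [d] of some expression of
    [one]; as one of them is invertible, [b = 0]. *)
Theorem faithfully_flatP (one : S) :
  (forall m (d : nat -> R) (t : nat -> S), one = \sum_(k < m) d k *: t k ->
     exists2 k, (k < m)%N & exists u, u * d k = 1) ->
  faithfully_flat S.
Proof.
move=> unit_coef A B C f g; split=> [ex|ex].
  apply/seteqP; split=> [_ [x _ <-]|y /= gy0].
    have [p ->] := tensor_sum x; rewrite /= !raddf_sum big1 // => z _.
    rewrite /= !tensor_map_tens.
    have -> : g (f z.1) = 0 by have : range f (f z.1) by []; rewrite ex.
    by rewrite linear0l.
  have [p pE] := tensor_sum y.
  have : \sum_(x <- [seq (g x.1, x.2) | x <- p]) tens x.1 x.2 = 0 :> tensor C S.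
    rewrite big_map -[RHS]gy0 pE raddf_sum; apply: eq_bigr => x _.
    by rewrite /= tensor_map_tens.
  move=> /tensor_eq0[m [t [q [pq q0]]]].
  have [q' [pq' gq']] := lift_preim pq.
  have /choice[a aP] : forall k, exists a, (k < m)%N -> f a = coord q' k.
    move=> k; have [km|] := ltnP k m; last by exists 0.
    have : [set y | g y = 0] (coord q' k) by rewrite /= gq' q0.
    by rewrite -ex => -[a _ fa]; exists a.
  exists (\sum_(k < m) tens (a k) (t k)) => //.
  rewrite pE pq' sum_push raddf_sum; apply: eq_bigr => k _.
  by rewrite /= tensor_map_tens aP.
apply/seteqP; split=> [_ [x _ <-]|y /= gy0].
  have : [set y | tensor_map g y = 0] (tens (f x) one).
    by rewrite -ex -(tensor_map_tens f x one); exists (tens x one).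
  rewrite /= tensor_map_tens => gf0.
  have [|m [t [q [pq q0]]]] := @tensor_eq0 _ [:: (g (f x), one)].
    by rewrite big_seq1.
  case: q pq q0 => [|y' [|//]] //= [e1 e2] q0.
  have [k km [u ud]] := unit_coef _ _ _ e2.
  rewrite -[LHS]scale1r -ud -scalerA e1; have := q0 k km.
  by rewrite /coord big_seq1 => ->; rewrite scaler0.
have : [set y | tensor_map g y = 0] (tens y one).
  by rewrite /= tensor_map_tens gy0 linear0l.
rewrite -ex => -[z _]; have [p ->] := tensor_sum z.
rewrite raddf_sum => e.
have : \sum_(x <- (y, one) :: [seq (- f x.1, x.2) | x <- p]) tens x.1 x.2 = 0 :> tensor B S.
  rewrite big_cons big_map /= -e -big_split big1 // => x _ /=.
  by rewrite tensor_map_tens linearNl subrr.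
move=> /tensor_eq0[m [t [[|x q] [//= [e1 e2 pq] q0]]]].
have [k km [u ud]] := unit_coef _ _ _ e2.
have := q0 k km; rewrite /coord big_cons -e1 => /eqP; rewrite addr_eq0 => /eqP dy.
have fq : range f (\sum_(x <- q) x.2 k *: x.1).
  elim: (p) (q) pq => [|z' p' IH] [|x' q2] //=.
    by move=> _; rewrite big_nil; exists 0 => //; rewrite raddf0.
  move=> [e3 e4 /IH[a _ fa]]; rewrite big_cons -e3 -fa.
  by exists (x'.2 k *: (- z'.1) + a) => //; rewrite linearP raddfN.
rewrite -[y]scale1r -ud -scalerA dy; case: fq => a _ <-.
by exists (u *: - a) => //; rewrite linearZ raddfN.
Qed.

End FlatModule.

(** * Prime ideals of Noetherian rings *)

Section Primes.
Variable R : comPzRingType.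
Hypothesis nR : noetherian R.
Implicit Types (I P Q : set R) (x y : R).

(** Noetherian induction: if [x * y] is in [I], then every prime over [I] is over
    [I + (x)] or over [I + (y)]. *)
Lemma primes_over I : is_ideal I -> exists ps : seq (set R),
  (forall P, P \in ps -> prime_ideal P /\ I `<=` P) /\
  (forall Q, prime_ideal Q -> I `<=` Q -> exists2 P, P \in ps & P `<=` Q).
Proof.
move: I; apply: (noeth_ind nR) => I hI IH.
have [I1|nI1] := pselect (I 1).
  by exists [::]; split=> // Q [_ Q1 _] /(_ _ I1).
have [pI|[x [y [Ixy Ix Iy]]]] := prime_or_split hI nI1.
  exists [:: I]; split=> [P|Q _ IQ]; last by exists I; rewrite ?mem_head.
  by rewrite inE => /eqP ->; split.
have [||psx [psxP psxQ]] := IH (adjoin I x).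
- exact: is_ideal_adjoin.
- exact: adjoin_proper.
have [||psy [psyP psyQ]] := IH (adjoin I y).
- exact: is_ideal_adjoin.
- exact: adjoin_proper.
exists (psx ++ psy); split=> [P|Q pQ IQ].
  rewrite mem_cat => /orP[/psxP|/psyP] [pP sP]; split=> //;
  exact: subset_trans (@sub_adjoin _ _ _) sP.
have hQ := prime_is_ideal pQ.
have [Qx|Qy] := prime_mul pQ (IQ _ Ixy).
  have [P Pps PQ] := psxQ Q pQ (adjoin_sub hQ IQ Qx).
  by exists P => //; rewrite mem_cat Pps.
have [P Pps PQ] := psyQ Q pQ (adjoin_sub hQ IQ Qy).
by exists P => //; rewrite mem_cat Pps orbT.
Qed.

Lemma minimal_in_seq (ps : seq (set R)) Q : exists P,
  [/\ P = Q \/ P \in ps, P `<=` Q &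
      forall P', P' \in ps -> P' `<=` P -> P `<=` P'].
Proof.
elim: ps => [|P0 ps [P [PQ sPQ Pmin]]]; first by exists Q; split=> //; left.
have [P0P|nP0P] := pselect (P0 `<=` P).
  exists P0; split=> [||P']; first by right; rewrite mem_head.
    exact: subset_trans P0P sPQ.
  rewrite inE => /predU1P[-> //|/Pmin P'P P'P0].
  by apply: (subset_trans P0P); apply: P'P; exact: subset_trans P'P0 P0P.
exists P; split=> // [|P'].
  by case: PQ => [|Pps]; [left|right; rewrite inE Pps orbT].
by rewrite inE => /predU1P[-> //|]; exact: Pmin.
Qed.

Lemma minimal_prime I Q : is_ideal I -> prime_ideal Q -> I `<=` Q ->
  exists P, [/\ prime_ideal P, I `<=` P, P `<=` Q &
    forall P', prime_ideal P' -> I `<=` P' -> P' `<=` P -> P `<=` P'].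
Proof.
move=> hI pQ IQ; have [ps [psP psQ]] := primes_over hI.
have [P1 P1ps P1Q] := psQ Q pQ IQ.
have [P [PP1 sPP1 Pmin]] := minimal_in_seq ps P1.
have Pps : P \in ps by case: PP1 => [->|].
have [pP IP] := psP P Pps; exists P; split=> //; first exact: subset_trans sPP1 P1Q.
move=> P' pP' IP' P'P; have [P2 P2ps P2P'] := psQ P' pP' IP'.
by apply: subset_trans _ (P2P'); apply: Pmin => //; exact: subset_trans P2P' P'P.
Qed.

(** An element [x] that avoids all the primes but [P] is corrected by some [e]
    outside [P] that lies in all the primes not inside [P]. The primes inside [P]
    are avoided as soon as [P] is. *)
Lemma prime_avoidance Q (ps : seq (set R)) : is_ideal Q ->
  (forall P, P \in ps -> prime_ideal P) ->
  exists x, Q x /\ forall P, P \in ps -> ~ (Q `<=` P) -> ~ P x.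
Proof.
move=> hQ; elim: ps => [|P ps IH] pps; first by exists 0; split=> //; exact: id0.
have pP : prime_ideal P by apply: pps; rewrite mem_head.
have [|x [Qx xps]] := IH; first by move=> P' P'ps; apply: pps; rewrite inE P'ps orbT.
have [[Px nQP]|nP] := pselect (P x /\ ~ (Q `<=` P)); last first.
  exists x; split=> // P'; rewrite inE => /predU1P[->|/xps//] nQP Px.
  by apply: nP.
have [e [Qe Pe eps]] : exists e, [/\ Q e, ~ P e &
    forall P', P' \in ps -> ~ (P' `<=` P) -> P' e].
  have {}pps P' : P' \in ps -> prime_ideal P'.
    by move=> P'ps; apply: pps; rewrite inE P'ps orbT.
  elim: (ps) pps => [|P' ps' IHps] pps'.
    by move/existsNP: nQP => [e /not_implyP[Qe Pe]]; exists e.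
  have [|e [Qe Pe eps]] := IHps; first by move=> P2 P2ps; apply: pps'; rewrite inE P2ps orbT.
  have pP' : prime_ideal P' by apply: pps'; rewrite mem_head.
  have [sP'P|/existsNP[y /not_implyP[P'y Py]]] := pselect (P' `<=` P).
    exists e; split=> // P2; rewrite inE => /predU1P[-> //|]; exact: eps.
  exists (y * e); split; [exact: idMl|by move/(prime_mul pP) => -[]|].
  move=> P2; rewrite inE => /predU1P[-> _|P2ps nP2P].
    by apply: idMr => //; exact: prime_is_ideal.
  apply: idMl; last exact: eps.
  by apply: prime_is_ideal; apply: pps'; rewrite inE P2ps orbT.
have hP := prime_is_ideal pP.
have Pxe : ~ P (x + e) by rewrite addrC => /(id_addr hP Px).
exists (x + e); split; first exact: idD.
move=> P'; rewrite inE => /predU1P[-> //|P'ps nQP' P'xe].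
have [sP'P|nP'P] := pselect (P' `<=` P); first exact/Pxe/sP'P.
have hP' : is_ideal P' by apply/prime_is_ideal/pps; rewrite inE P'ps orbT.
by apply: (xps P') => //; exact: id_addr hP' (eps _ P'ps nP'P) P'xe.
Qed.

(** ** Ideals saturated at a prime *)

Definition saturated Q I := forall t x, ~ Q t -> I (t * x) -> I x.

Definition saturation Q I : set R := [set x | exists2 t, ~ Q t & I (t * x)].

Lemma is_ideal_saturation Q I : prime_ideal Q -> is_ideal I ->
  is_ideal (saturation Q I).
Proof.
move=> pQ hI; split=> [|x y [t Qt Ix] [u Qu Iy]|a x [t Qt Ix]].
- by exists 1; [case: pQ|rewrite mulr0; exact: id0].
- exists (t * u); first by move/(prime_mul pQ) => -[].
  have -> : t * u * (x + y) = u * (t * x) + t * (u * y) by ring.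
  by apply: idD => //; exact: idMl.
- by exists t => //; rewrite mulrCA; exact: idMl.
Qed.

Lemma saturation_saturated Q I : prime_ideal Q -> saturated Q (saturation Q I).
Proof.
move=> pQ t x Qt [u Qu Ix]; exists (u * t); last by rewrite -mulrA.
by move/(prime_mul pQ) => -[].
Qed.

Lemma sub_saturation Q I : prime_ideal Q -> I `<=` saturation Q I.
Proof. by move=> pQ x Ix; exists 1; [case: pQ|rewrite mul1r]. Qed.

Lemma saturation_sub Q I K : saturated Q K -> I `<=` K -> saturation Q I `<=` K.
Proof. by move=> sK IK x [t Qt /IK]; exact: sK. Qed.

Section MinimalOver.
Variables (Q C0 : set R).
Hypotheses (pQ : prime_ideal Q)
  (Qmin : forall P, prime_ideal P -> C0 `<=` P -> P `<=` Q -> Q `<=` P).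

(** [Q] is associated to every proper saturated ideal over [C0]: a maximal
    annihilator is a prime between [C0] and [Q]. *)
Lemma saturated_socle C : is_ideal C -> saturated Q C -> C0 `<=` C -> ~ C 1 ->
  exists s, ~ C s /\ forall q, Q q -> C (q * s).
Proof.
move=> hC sC C0C C1.
have [|K [hK [s [Cs KE]] _ Kmax]] := noeth_max
    (P := fun K => exists s, ~ C s /\ K = colon C s) nR (is_ideal_colon 1 hC).
  by exists 1.
exists s; split=> //; suff QK : Q `<=` K by move=> q /QK; rewrite KE.
apply: Qmin.
- split=> //; first by rewrite KE /colon /= mul1r.
  move=> x y Kxy; have [Ky|nKy] := pselect (K y); [by right|left].
  have nCys : ~ C (y * s) by move: nKy; rewrite KE.
  apply: (Kmax (colon C (y * s))); first exact: is_ideal_colon.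
  + by exists (y * s).
  + by rewrite KE => k; rewrite /colon /= mulrCA; exact: idMl.
  + by move: Kxy; rewrite KE /colon /= mulrA.
- by move=> c /C0C Cc; rewrite KE /colon /=; exact: idMr.
- move=> t; rewrite KE /colon /= => Cts; apply: contrapT => Qt.
  by apply: Cs; exact: sC Cts.
Qed.

(** The localization of [R / C0] at [Q] is Artinian. By Noetherian induction, the
    descending chains over [C + (s)] stop, for [s] a socle element of [C]; and [s]
    is either in all the terms of a chain over [C] or outside all but finitely
    many of them. *)
Lemma saturated_dcc C : is_ideal C -> saturated Q C -> C0 `<=` C ->
  forall B : nat -> set R, (forall n, is_ideal (B n)) ->
    (forall n, saturated Q (B n)) -> (forall n, C `<=` B n) ->
    (forall n, B n.+1 `<=` B n) -> exists n, B n `<=` B n.+1.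
Proof.
move: C; apply: (noeth_ind nR) => C hC IH sC C0C B hB sB CB Bdec.
have [C1|nC1] := pselect (C 1).
  by exists 0%N => x _; apply: CB; rewrite (idT hC C1).
have [s [Cs Qs]] := saturated_socle hC sC C0C nC1.
pose C' := saturation Q (adjoin C s).
have hC' : is_ideal C' by apply: is_ideal_saturation => //; exact: is_ideal_adjoin.
have CC' : C `<` C'.
  have aC' : adjoin C s `<=` C' by exact: sub_saturation.
  split; first exact: subset_trans (@sub_adjoin _ _ _) aC'.
  by move=> C'C; apply/Cs/C'C/aC'; exact: mem_adjoin.
have sC' : saturated Q C' by exact: saturation_saturated.
have C0C' : C0 `<=` C' by apply: subset_trans C0C _; case: CC'.
have [Bs|/existsNP[n2 nBs]] := pselect (forall n, B n s).
  by apply: (IH C') => // n; apply: saturation_sub => //; exact: adjoin_sub.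
have Bn2 n : B (n + n2)%N `<=` B n2.
  by elim: n => // n; apply: subset_trans; rewrite addSn; exact: Bdec.
have [||||n Dn] := IH C' hC' CC' sC' C0C' (fun n => saturation Q (adjoin (B (n + n2)%N) s)).
- by move=> n; apply: is_ideal_saturation => //; exact: is_ideal_adjoin.
- by move=> n; exact: saturation_saturated.
- move=> n; apply: saturation_sub; first exact: saturation_saturated.
  apply: subset_trans _ (sub_saturation pQ).
  apply: adjoin_sub; [exact: is_ideal_adjoin| |exact: mem_adjoin].
  by apply: subset_trans _ (@sub_adjoin _ _ _); exact: CB.
- move=> n; apply: saturation_sub; first exact: saturation_saturated.
  apply: subset_trans _ (sub_saturation pQ).
  apply: adjoin_sub; [exact: is_ideal_adjoin| |exact: mem_adjoin].
  by apply: subset_trans _ (@sub_adjoin _ _ _); exact: Bdec.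
exists (n + n2)%N => b Bb.
have [|t Qt [b' [r [Bb' e]]]] := Dn b.
  by apply: sub_saturation => //; exact: sub_adjoin.
apply: (sB _ t) => //; rewrite e; apply: idD => //.
apply: CB; apply: Qs; apply: contrapT => Qr.
apply: nBs; apply: (Bn2 n); apply: (sB _ r) => //.
have -> : r * s = t * b - b' by rewrite e addrC addKr.
by apply: idB; [exact: hB|exact: idMl|exact: Bdec].
Qed.

End MinimalOver.

(** For [b] in [P] outside [Q0], let [B n] be the contraction to [R] of the ideal
    [Q0 + (b ^ n)] of the localization at [P]. This descending chain stops modulo
    [a], because [Q] is minimal over [Q0 + (a)]; as [a] is not in [P], it stops by
    Nakayama's lemma. Then [b ^ n] is in [Q0 + (b ^ n.+1)] locally at [P], which
    puts [b] in [Q0]. *)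
Theorem krull_principal_ideal Q0 P Q a : prime_ideal Q0 -> prime_ideal P ->
  prime_ideal Q -> Q a ->
  (forall P', prime_ideal P' -> Q0 `<=` P' -> P' a -> P' `<=` Q -> Q `<=` P') ->
  Q0 `<` P -> P `<` Q -> False.
Proof.
move=> pQ0 pP pQ Qa Qmin [Q0P nPQ0] [PQ nQP].
have [hQ0 hP hQ] := And3 (prime_is_ideal pQ0) (prime_is_ideal pP) (prime_is_ideal pQ).
have Pa : ~ P a by move=> Pa; apply: nQP; exact: Qmin.
have [b Pb Q0b] : exists2 b, P b & ~ Q0 b.
  by move/existsNP: nPQ0 => [b /not_implyP[Pb Qb]]; exists b.
pose B n := saturation P (adjoin Q0 (b ^+ n)).
have hB n : is_ideal (B n) by apply: is_ideal_saturation => //; exact: is_ideal_adjoin.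
have sPB n : saturated P (B n) by exact: saturation_saturated.
have sQB n : saturated Q (B n) by move=> t x Qt; apply: sPB => /PQ.
have aB n : adjoin Q0 (b ^+ n) `<=` B n by exact: sub_saturation.
have Q0B n : Q0 `<=` B n by apply: subset_trans _ (aB n); exact: sub_adjoin.
have Bb n : B n (b ^+ n) by apply: aB; exact: mem_adjoin.
have Bdec n : B n.+1 `<=` B n.
  apply: saturation_sub => //; apply: adjoin_sub => //.
  by rewrite exprS; exact: idMl.
pose C := saturation Q (adjoin Q0 a).
have hC : is_ideal C by apply: is_ideal_saturation => //; exact: is_ideal_adjoin.
have [|||||||n Dn] := @saturated_dcc Q (adjoin Q0 a) pQ _ C hC _ _
    (fun n => saturation Q (adjoin (B n) a)).
- move=> P' pP' aP' P'Q; apply: Qmin => //.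
    exact: subset_trans (@sub_adjoin _ _ _) aP'.
  by apply: aP'; exact: mem_adjoin.
- exact: saturation_saturated.
- exact: sub_saturation.
- by move=> n; apply: is_ideal_saturation => //; exact: is_ideal_adjoin.
- by move=> n; exact: saturation_saturated.
- move=> n; apply: saturation_sub; first exact: saturation_saturated.
  apply: subset_trans _ (sub_saturation pQ).
  apply: adjoin_sub; [exact: is_ideal_adjoin| |exact: mem_adjoin].
  by apply: subset_trans _ (@sub_adjoin _ _ _); exact: Q0B.
- move=> n; apply: saturation_sub; first exact: saturation_saturated.
  apply: subset_trans _ (sub_saturation pQ).
  apply: adjoin_sub; [exact: is_ideal_adjoin| |exact: mem_adjoin].
  by apply: subset_trans _ (@sub_adjoin _ _ _); exact: Bdec.
have BB : B n `<=` B n.+1.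
  apply: (nakayama nR pQ (hB n) (hB n.+1) (@sQB n.+1)) => s Bs.
  have [|t Qt [y [r [By e]]]] := Dn s.
    by apply: sub_saturation => //; exact: sub_adjoin.
  exists t, y, (a * r); split=> //; last by rewrite [a * r]mulrC.
  apply: mem_mul => //; apply: (sPB n a) => //.
  have -> : a * r = t * s - y by rewrite e [a * r]mulrC addrC addKr.
  by apply: idB; [exact: hB|exact: idMl|exact: Bdec].
have [t Pt [q [r [Q0q e]]]] := BB _ (Bb n).
have /(prime_mul pQ0)[/(prime_pow pQ0)//|Q0t] : Q0 (b ^+ n * (t - r * b)).
  have -> : b ^+ n * (t - r * b) = t * b ^+ n - r * b ^+ n.+1 by rewrite exprS; ring.
  by rewrite e addrK.
apply: Pt; rewrite -(subrK (r * b) t); apply: idD => //; first exact: Q0P.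
exact: idMl.
Qed.

(** Between [Q1] and [Q3] take a prime minimal over [Q1 + (x + u c * y)] for each
    index [c]. By the principal ideal theorem it misses [y], because [x] avoids
    the minimal primes of [Q1 + (y)]. A prime that serves two indices contains
    [(u c - u c') * y], hence a power of [z] times [y], hence [y], as [y] is a
    multiple of [z]. *)
Theorem many_intermediate_primes (T : Type) (u : T -> R) z Q1 Q2 Q3 :
  prime_ideal Q1 -> prime_ideal Q2 -> prime_ideal Q3 -> Q1 `<` Q2 -> Q2 `<` Q3 ->
  ~ Q1 z ->
  (forall c c', c <> c' -> exists n v w, u c - u c' = z ^+ n * v /\ v * w = 1) ->
  exists F : T -> set R, injective F /\
    forall c, prime_ideal (F c) /\ Q1 `<` F c /\ F c `<` Q3.
Proof.
move=> p1 p2 p3 [s12 ns21] [s23 ns32] Q1z udiff.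
have [h1 h2 h3] := And3 (prime_is_ideal p1) (prime_is_ideal p2) (prime_is_ideal p3).
have [w Q2w Q1w] : exists2 w, Q2 w & ~ Q1 w.
  by move/existsNP: ns21 => [w /not_implyP[Q2w Q1w]]; exists w.
pose y := z * w.
have Q2y : Q2 y by exact: idMl.
have Q1y : ~ Q1 y by move/(prime_mul p1) => -[].
have [ps [psP psQ]] := primes_over (is_ideal_adjoin y h1).
have [|x [Q3x xps]] := prime_avoidance (ps := ps) h3; first by move=> P /psP[].
(* such a P lies over one of the primes ps, which misses x *)
have xP P : prime_ideal P -> Q1 `<=` P -> P y -> P x ->
    Q3 `<=` P \/ exists P', [/\ prime_ideal P', Q1 `<` P' & P' `<` P].
  move=> pP sQ1P Py Px; have hP := prime_is_ideal pP.
  have [P' P'ps P'P] := psQ P pP (adjoin_sub hP sQ1P Py).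
  have [pP' sP'] := psP P' P'ps.
  have [Q3P'|nQ3P'] := pselect (Q3 `<=` P'); first by left; exact: subset_trans Q3P' P'P.
  right; exists P'; split=> //; split=> //.
  - exact: subset_trans (@sub_adjoin _ _ _) sP'.
  - by move=> P'Q1; apply/Q1y/P'Q1/sP'; exact: mem_adjoin.
  - by move=> PP'; apply: (xps P') => //; exact: PP'.
have Q1xy a : ~ Q1 (x + a * y).
  move=> Q1xy; have [P' P'ps P'Q2] := psQ Q2 p2 (adjoin_sub h2 s12 Q2y).
  have [pP' sP'] := psP P' P'ps; have hP' := prime_is_ideal pP'.
  have P'y : P' y by apply: sP'; exact: mem_adjoin.
  apply: (xps P') => // [Q3P'|]; first by apply: ns32; exact: subset_trans Q3P' P'Q2.
  apply: (id_addr hP' (idMl a hP' P'y)); apply: sP'; exact: sub_adjoin.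
have Q3xy a : adjoin Q1 (x + a * y) `<=` Q3.
  apply: adjoin_sub => //; first exact: subset_trans s12 s23.
  by apply: idD => //; apply: idMl => //; exact: s23.
have /choice[F FP] := fun c => minimal_prime (is_ideal_adjoin (x + u c * y) h1) p3 (Q3xy (u c)).
have pF c : prime_ideal (F c) by case: (FP c).
have Fxy c : F c (x + u c * y) by case: (FP c) => _ sF _ _; apply: sF; exact: mem_adjoin.
have Q1F c : Q1 `<=` F c.
  by case: (FP c) => _ sF _ _; apply: subset_trans _ sF; exact: sub_adjoin.
have FQ3 c : F c `<=` Q3 by case: (FP c).
have pit c P : prime_ideal P -> Q1 `<` P -> P `<` F c -> False.
  move=> pP; apply: (krull_principal_ideal p1 pP (pF c) (Fxy c)) => P' pP' Q1P' P'xy.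
  by case: (FP c) => _ _ _; apply => //; apply: adjoin_sub => //; exact: prime_is_ideal.
have nQ3F c : ~ (Q3 `<=` F c).
  move=> Q3F; apply: (pit c Q2 p2); first by split.
  split; first exact: subset_trans s23 Q3F.
  by move=> FQ2; apply: ns32; exact: subset_trans Q3F FQ2.
have Fy c : ~ F c y.
  move=> Fcy; have hF := prime_is_ideal (pF c).
  have Fx : F c x by apply: (id_addr hF (idMl (u c) hF Fcy)); exact: Fxy.
  by have [/nQ3F|[P' [pP' Q1P' /(pit c P' pP' Q1P')]]] := xP _ (pF c) (Q1F c) Fcy Fx.
exists F; split=> [c c' Fcc'|c].
  apply: contrapT => /udiff[n [v [w' [uE vw]]]].
  have hF := prime_is_ideal (pF c).
  have : F c (z ^+ n * y).
    have -> : z ^+ n * y = w' * ((x + u c * y) - (x + u c' * y)).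
      have -> : (x + u c * y) - (x + u c' * y) = (u c - u c') * y by ring.
      by rewrite uE -[LHS]mul1r -vw; ring.
    by apply: (idMl _ hF); apply: (idB hF) => //; rewrite Fcc'.
  move=> /(prime_mul (pF c))[/(prime_pow (pF c)) Fz|]; last exact: Fy.
  by apply: (Fy c); exact: idMr.
split=> //; split; split=> //.
by move=> FQ1; apply: (Q1xy (u c)); exact: FQ1.
Qed.

End Primes.

(** * Counting primes *)

Lemma card_le_of_inj (T U : Type) (A : set T) (B : set U) (F : T -> U) :
  (forall x, A x -> B (F x)) ->
  (forall x y, A x -> A y -> F x = F y -> x = y) -> A #<= B.
Proof.
move=> AB Finj; have FI : {in A &, injective F}.
  by move=> x y /set_mem Ax /set_mem Ay; exact: Finj.
rewrite -(card_le_eql (inj_card_eq FI)); apply: subset_card_le.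
by move=> _ [x Ax <-]; exact: AB.
Qed.

Section Digits.
Variables (R S : comPzRingType) (f : {rmorphism R -> S}) (J M : ideal R).
Hypotheses (hR : local_ring M) (JM : J `<=` M) (cS : is_completion f J).

Notation E k := (powI (ext f J) k).
Let hE k : is_ideal (E k). Proof. exact: is_ideal_pow. Qed.

(** Not additive: [repr] picks an arbitrary representative of a residue class. *)
Definition digit (c : ring_quot M) : S := f (repr c).

(** Here [u c] is the power series in [z] with digits [c]. The difference of two
    series starts at the first place where the digits differ, and there its
    coefficient is a unit, because distinct residue classes differ by a unit. *)
Lemma digit_series z : extI f J z -> exists u : (nat -> ring_quot M) -> S,
  forall c c', c <> c' -> exists n v w, u c - u c' = z ^+ n * v /\ v * w = 1.
Proof.
move=> Jz; have /choice[u uP] : forall c : nat -> ring_quot M,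
    exists l, forall k, E k (l - \sum_(i < k) digit (c i) * z ^+ i).
  move=> c; apply: (compl_series cS (u := fun i => digit (c i) * z ^+ i)) => k.
  by apply: (idMl _ (hE k)); exact: mem_pow.
have shift c : u c = digit (c 0%N) + z * u (fun i => c i.+1).
  apply: (compl_eq cS) => k.
  have := uP c k.+1; rewrite big_ord_recl expr0 mulr1 => /ideal_powS_sub uck.
  have uck' := idMl z (hE k) (uP (fun i => c i.+1) k).
  rewrite -(subrK (digit (c 0%N) + \sum_(i < k) digit (c i.+1) * z ^+ i.+1) (u c)).
  rewrite -addrA; apply: (idD (hE k)) => //.
  have -> : \sum_(i < k) digit (c i.+1) * z ^+ i.+1 =
      z * \sum_(i < k) digit (c i.+1) * z ^+ i.
    by rewrite mulr_sumr; apply: eq_bigr => i _; rewrite exprS mulrCA.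
  apply: (idBC (hE k)); move: uck'; rewrite mulrBr; congr ideal_set.
  ring.
have NE := is_ideal_ext f M.
have lead n : forall c c', (forall i, (i < n)%N -> c i = c' i) -> c n <> c' n ->
    exists v w, u c - u c' = z ^+ n * v /\ v * w = 1.
  elim: n => [|n IH] c c' cc' ccn.
    have [|w vw] := local_unit (ext_local hR JM cS) (x := u c - u c').
      rewrite (shift c) (shift c') => Nuu; apply: ccn.
      rewrite -[c 0%N]quot_mapK -[c' 0%N]quot_mapK; apply/quot_mapP.
      apply: (ext_contract cS (ideal_setP M) JM); rewrite rmorphB -/(digit _) -/(digit _).
      apply: (id_addr NE (y := z * u (fun i => c i.+1) - z * u (fun i => c' i.+1))).
        by rewrite -mulrBr; apply: (idMr _ NE); exact: ext_mono Jz.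
      by move: Nuu; congr ideal_set; ring.
    by exists (u c - u c'), w; rewrite expr0 mul1r.
  have [||v [w [uu vw]]] := IH (fun i => c i.+1) (fun i => c' i.+1).
  - by move=> i ni; apply: cc'.
  - exact: ccn.
  exists v, w; split=> //; rewrite (shift c) (shift c') cc' // exprS -mulrA -uu.
  ring.
exists u => c c' ncc'.
have [|n cn nmin] := ex_minnP (P := fun i => c i != c' i).
  apply: contrapT => nex; apply: ncc'; apply: functional_extensionality_dep => i.
  by apply/eqP; apply: contrapT => /negP ci; apply: nex; exists i.
exists n; apply: lead; last exact/eqP.
by move=> i ni; apply/eqP; apply: contraTT ni => /nmin; rewrite -leqNgt.
Qed.

End Digits.

Section CountCompletion.
Variables (R T : comPzRingType) (f : {rmorphism R -> T}) (M : ideal R).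
Hypotheses (hR : local_ring M) (cT : is_completion f M).

Let nR : noetherian R. Proof. by case: hR. Qed.
Let nT : noetherian T. Proof. exact: completion_noetherian cT nR. Qed.
Notation E k := (powI (ext f M) k).
Let hE k : is_ideal (E k). Proof. exact: is_ideal_pow. Qed.

(** Successive approximation: the digits at stage [n] are residue classes of
    coefficients with respect to chosen generators of [M ^ n]. *)
Lemma expand_digits : exists G : T -> nat -> nat -> ring_quot M, injective G.
Proof.
have /choice[g gE] : forall n, exists g, powI M n = span g.
  by move=> n; exact: noeth_fg nR (is_ideal_pow M n).
pose term n (c : nat -> ring_quot M) :=
  \sum_(l < size (g n)) digit f (c l) * f (g n)`_l.
have /choice[D DP] : forall nt : nat * T, exists c,
    E nt.1 nt.2 -> E nt.1.+1 (nt.2 - term nt.1 c).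
  move=> [n t] /=; have [Et|nEt] := pselect (E n t); last by exists (fun=> 0).
  have : span (map f (g n)) t by rewrite -ext_span -gE -ext_pow.
  move=> [y ->]; have /choice[r rP] := fun l => compl_dense cT (y l) 1.
  exists (fun l => quot_map M (r l)) => _; rewrite size_map /term -sumrB.
  apply: (id_sum (F := fun l => y l * (map f (g n))`_l -
    digit f (quot_map M (r l)) * f (g n)`_l) (hE n.+1)) => l lg.
  rewrite (nth_map 0) // -mulrBl -add1n; apply: pow_add; last first.
    by rewrite ext_pow; apply: mem_ext; rewrite gE; apply: mem_span; exact: mem_nth.
  have -> : y l - digit f (quot_map M (r l)) =
     (y l - f (r l)) + f (r l - repr (quot_map M (r l))) by rewrite rmorphB addrA subrK.
  apply: (idD (hE 1)) => //; rewrite pow1; apply: mem_ext; apply/quot_mapP.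
  by rewrite quot_mapK.
pose rest t := fix rest n := if n is m.+1 then rest m - term m (D (m, rest m)) else t.
have restE t n : E n (rest t n).
  by elim: n => // n IH; exact: (DP (n, rest t n)).
exists (fun t n => D (n, rest t n)) => t t' tt'.
apply: (compl_eq cT) => n; have -> : t - t' = rest t n - rest t' n.
  elim: n => // n -> /=; have -> : D (n, rest t n) = D (n, rest t' n).
    by have /(congr1 (fun F => F n)) := tt'.
  ring.
by apply: (idB (hE n)); exact: restE.
Qed.

(** As [T] is Noetherian, a prime is coded by the digits of its generators. *)
Lemma card_Spec_completion : Spec T #<= [set: nat -> ring_quot M].
Proof.
have [G Ginj] := expand_digits.
have /choice[H HP] : forall P : set T, exists s : seq T, is_ideal P -> P = span s.
  move=> P; have [hP|] := pselect (is_ideal P); last by exists [::].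
  by have [s ->] := noeth_fg nT hP; exists s.
pose code P (k : nat) :=
  let: (i, n, l) := odflt (0, 0, 0)%N (unpickle k) in G (H P)`_i n l.
apply: (@card_le_of_inj _ _ _ _ code) => // P Q /prime_is_ideal hP /prime_is_ideal hQ PQ.
have HPQ i : (H P)`_i = (H Q)`_i.
  apply: Ginj; apply: functional_extensionality_dep => n.
  apply: functional_extensionality_dep => l.
  have /(congr1 (fun F => F (pickle (i, n, l)))) := PQ.
  by rewrite /code pickleK.
have sub (P' Q' : set T) : is_ideal P' -> is_ideal Q' ->
    (forall i, (H P')`_i = (H Q')`_i) -> P' `<=` Q'.
  move=> hP' hQ' e; rewrite [X in X `<=` _](HP _ hP'); apply: span_sub => // x.
  move=> /(nthP 0)[i _ <-]; rewrite e.
  have [iQ|Qi] := ltnP i (size (H Q')); last by rewrite nth_default //; exact: id0.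
  by rewrite [X in X _](HP _ hQ'); apply: mem_span; exact: mem_nth.
by apply/seteqP; split; apply: sub.
Qed.

(** Contraction along a completion is surjective on primes: by Krull's theorem
    [Q] is the contraction of its extension, so an ideal maximal among those that
    contract into [Q] is a prime over [Q]. *)
Lemma contraction_surj Q : prime_ideal Q ->
  exists2 P, prime_ideal P & f @^-1` P = Q.
Proof.
move=> pQ; have hQ := prime_is_ideal pQ.
have [|P [hP PQ QP Pmax]] := noeth_max (P := fun P => f @^-1` P `<=` Q) nT
    (is_ideal_ext f Q).
  move=> x Qx; apply: (krull hR (J := M) _ hQ) => // k.
  apply: (ext_contract_approx cT (e := 0)) => //; first by rewrite subr0.
  exact: id0 (hE k).
exists P; last first.
  by apply/seteqP; split=> // x Qx; apply: QP; exact: mem_ext.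
split=> // [P1|x y Pxy]; first by case: pQ => _ + _; apply; apply: PQ; rewrite /preimage /= rmorph1.
apply: contrapT => /not_orP[Px Py].
have out a : ~ P a -> exists2 q, ~ Q q & adjoin P a (f q).
  move=> Pa; apply: contrapT => no; apply: Pa.
  apply: (Pmax (adjoin P a)); [exact: is_ideal_adjoin| |exact: sub_adjoin|exact: mem_adjoin].
  by move=> q Pq; apply: contrapT => Qq; apply: no; exists q.
have [[q Qq [i [r [Pi qE]]]] [q' Qq' [i' [r' [Pi' qE']]]]] := (out x Px, out y Py).
have : Q (q * q').
  apply: PQ; rewrite /preimage /= rmorphM qE qE'.
  have -> : (i + r * x) * (i' + r' * y) = (i' + r' * y) * i + ((r * x) * i' + (r * r') * (x * y)).
    by ring.
  by apply: idD => //; [exact: idMl|apply: idD => //; exact: idMl].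
by move/(prime_mul pQ) => -[].
Qed.

Lemma card_Spec_le_completion : Spec R #<= Spec T.
Proof.
have /choice[G GP] : forall Q : set R, exists P : set T, prime_ideal Q ->
    prime_ideal P /\ f @^-1` P = Q.
  move=> Q; have [/contraction_surj[P pP PQ]|] := pselect (prime_ideal Q); last by exists set0.
  by exists P.
apply: (@card_le_of_inj _ _ _ _ G) => [Q /GP[]//|P Q /GP[_ {2}<-] /GP[_ {2}<-] ->] //.
Qed.

End CountCompletion.

Lemma card_Spec_isom (A B : comPzRingType) : ring_isom A B -> Spec A #<= Spec B.
Proof.
case=> f /rmorph_inverse[g [fK gK]].
apply: (@card_le_of_inj _ _ _ _ (fun P => g @^-1` P)) => [P pP|P Q _ _ PQ].
  exact: prime_preim.
apply: functional_extensionality_dep => x; rewrite -[x]fK.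
exact: (congr1 (fun X : set B => X (f x)) PQ).
Qed.

(** * The extension *)

(** An alias of [S] that carries the [R]-algebra structure defined by [f]. *)
Definition alg_of (R S : comNzRingType) (f : {rmorphism R -> S}) : Type := S.

Section AlgebraOfMorphism.
Variables (R S : comNzRingType) (f : {rmorphism R -> S}).
Notation alg_of := (alg_of f).

HB.instance Definition _ := GRing.ComNzRing.on alg_of.

Let scale (r : R) (s : alg_of) : alg_of := f r * s.

Let scaleA r r' s : scale r (scale r' s) = scale (r * r') s.
Proof. by rewrite /scale rmorphM mulrA. Qed.

Let scale1 : left_id 1 scale.
Proof. by move=> s; rewrite /scale rmorph1 mul1r. Qed.

Let scaleDr : right_distributive scale +%R.
Proof. by move=> r s s'; rewrite /scale mulrDr. Qed.

Let scaleDl s : {morph scale^~ s : r r' / r + r'}.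
Proof. by move=> r r'; rewrite /scale rmorphD mulrDl. Qed.

HB.instance Definition _ :=
  GRing.Zmodule_isLmodule.Build R alg_of scaleA scale1 scaleDr scaleDl.

Let scaleAl (r : R) (s t : alg_of) : r *: (s * t) = r *: s * t.
Proof. by rewrite -[LHS]/(scale _ _) -[r *: s]/(scale _ _) /scale mulrA. Qed.

HB.instance Definition _ :=
  GRing.Lmodule_isLalgebra.Build R alg_of scaleAl.

HB.instance Definition _ := GRing.Lalgebra_isComAlgebra.Build R alg_of.

Lemma alg_of_scale (r : R) (s : alg_of) : r *: s = f r * s.
Proof. by []. Qed.

Lemma in_alg_of : GRing.in_alg alg_of = f :> (R -> S).
Proof.
by apply: functional_extensionality_dep => r; rewrite /= /GRing.in_alg alg_of_scale mulr1.
Qed.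

End AlgebraOfMorphism.

Section CompletionAlgebra.
Variables (R S : comNzRingType) (f : {rmorphism R -> S}) (M I J : ideal R).
Hypotheses (hR : local_ring M) (JM : J `<=` M) (JI : J `<=` I)
  (JIM : (J : set R) = I \/ (J : set R) = M) (cS : is_completion f J).

Notation A := (alg_of f).
Notation N := (ext f M).

Let nR : noetherian R. Proof. by case: hR. Qed.
Let locS : local_ring N. Proof. exact: ext_local hR JM cS. Qed.
Let nS : noetherian S. Proof. by case: locS. Qed.

Lemma alg_of_local_extension : local_extension M (N : ideal A).
Proof.
split; [exact: locS|rewrite in_alg_of; exact: compl_inj hR JM cS|].
by rewrite in_alg_of => _ [x Mx <-]; exact: mem_ext.
Qed.

Lemma alg_of_faithfully_flat : faithfully_flat A.
Proof.
apply: (@faithfully_flatP R A _ 1); first exact: completion_flat hR JM cS.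
move=> m d t /(one_in_span hR JM cS)[k km Mdk]; exists k => //.
by have [u du] := local_unit hR Mdk; exists u; rewrite mulrC.
Qed.

Lemma completion_ext_isom : ring_isom (completion N) (completion M).
Proof.
apply: (completion_isom (f := f)) => [s k|r k]; first exact: ext_pow_dense JM cS s k.
split; first exact: ext_pow_contract JM cS r k.
by rewrite ext_pow; exact: mem_ext.
Qed.

Lemma quot_ext_isom : ring_isom (ring_quot (ext f I)) (ring_quot I).
Proof.
apply: (quot_isom (f := f)) => [s|r].
  have [r] := compl_dense cS s 1; rewrite pow1 => Jr; exists r.
  exact: ext_mono Jr.
split; last exact: mem_ext.
exact: (ext_contract cS (ideal_setP I) JI).
Qed.

Lemma card_between (Q1 Q2 Q3 : set S) :
  prime_ideal Q1 -> prime_ideal Q2 -> prime_ideal Q3 ->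
  Q1 `<` Q2 -> Q2 `<` Q3 -> ~ (ext f I `<=` Q1) ->
  [set Q' : set S | prime_ideal Q' /\ Q1 `<` Q' /\ Q' `<` Q3]
    #= Spec (completion M).
Proof.
move=> p1 p2 p3 s12 s23 nIQ1.
have nJQ1 : ~ (ext f J `<=` Q1).
  case: JIM => [->//|JE]; rewrite JE => NQ1; case: s12 => _; apply.
  apply: subset_trans NQ1; apply: (local_proper_sub locS (prime_is_ideal p2)).
  by case: p2.
have /existsNP[z /not_implyP[Jz Q1z]] := nJQ1.
apply: Cantor_Bernstein.
  apply: (@card_le_trans _ _ _ (Spec S)).
    by apply: subset_card_le => Q [].
  apply: card_le_trans (card_Spec_isom completion_ext_isom).
  exact: card_Spec_le_completion locS (to_compl_is_completion _ nS).
apply: card_le_trans (card_Spec_completion hR (to_compl_is_completion M nR)) _.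
have [u uP] := digit_series hR JM cS Jz.
have [F [Finj FP]] := many_intermediate_primes nS p1 p2 p3 s12 s23 Q1z uP.
by apply: (@card_le_of_inj _ _ _ _ F) => [c _|c c' _ _ /Finj]; first exact: FP.
Qed.

End CompletionAlgebra.

Theorem theorem4p8 (R : comNzRingType) (M I : ideal R) (hR : local_ring M) :
  exists (S : comAlgType R) (N : ideal S),
    [/\ local_extension M N,
        faithfully_flat S,
        ring_isom (completion N) (completion M),
        ring_isom (ring_quot (ideal_ext S I)) (ring_quot I) /\
        homeomorphic (spec (ring_quot (ideal_ext S I))) (spec (ring_quot I)) &
        forall Q1 Q2 Q3 : set S,
          prime_ideal Q1 -> prime_ideal Q2 -> prime_ideal Q3 ->
          Q1 `<` Q2 -> Q2 `<` Q3 ->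
          ~ (ideal_ext S I `<=` Q1) ->
          [set Q' : set S | prime_ideal Q' /\ Q1 `<` Q' /\ Q' `<` Q3]
            #= Spec (completion M)].
Proof.
have nR : noetherian R by case: hR.
(* the completion at the unit ideal would be the zero ring *)
have [J [JM JI JIM]] : exists J : ideal R,
    [/\ J `<=` M, J `<=` I & (J : set R) = I \/ (J : set R) = M].
  have [I1|I1] := pselect (ideal_set I 1).
    by exists M; split=> //; [rewrite (idT (ideal_setP I) I1)|right].
  exists I; split=> //; [exact: (local_proper_sub hR (ideal_setP I))|by left].
have cJ := to_compl_is_completion J nR.
have nz : (1 : completion J) != 0.
  apply/eqP => e; have /eqP := oner_neq0 R; apply.
  by apply: (compl_inj hR JM cJ); rewrite rmorph1 rmorph0.
pose C : comNzRingType := HB.pack (completion J)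
  (GRing.PzSemiRing_isNonZero.Build (completion J) nz).
pose f : {rmorphism R -> C} := @to_compl R J.
have cf : is_completion f J := cJ.
have IE : ideal_ext (alg_of f) I = ext f I by rewrite /ideal_ext in_alg_of.
exists (alg_of f), (ext f M); rewrite IE; split.
- exact: (alg_of_local_extension hR JM cf).
- exact: (alg_of_faithfully_flat hR JM cf).
- exact: (completion_ext_isom JM cf).
- have qI := quot_ext_isom JI cf.
  by split; [exact: qI|exact: homeomorphic_spec qI].
- exact: (card_between hR JM JIM cf).
Qed.
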